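(* Let $D$ be totally transcendental. Then for all $A\subseteq\mathfrak C$ and every infinite cardinal $\mu$ there is a $D^s_\mu$-primary model $M$ over $A$ of cardinality $|A|+|T|+|D|+\mu$. Moreover, $M$ is $D^s_\mu$-prime over $A$.
   Context: Setting. $T$ is a first-order theory in a language $L(T)$ (with $|T|$ infinite: the number of $L(T)$-formulas), $\overline M$ is a very large saturated model of $T$; all sets are subsets of $\overline M$, all models are elementary submodels of $\overline M$. Barred letters are finite sequences; $\bar a\in A$ means all entries lie in $A$. $\operatorname{tp}(\bar c,A)$ is the complete type of $\bar c$ over $A$ in $\overline M$. $D(T)$ is the set of complete types over $\emptyset$ in finitely many variables. For a set of formulas $p$, $\operatorname{dom}(p)$ is the set of its parameters, $p$ is over $A$ if $\operatorname{dom}(p)\subseteq A$, and $p\restriction B$ is the set of formulas of $p$ with parameters in $B$. Fix $D\subseteq D(T)$. $A$ is a $D$-set if $\operatorname{tp}(\bar c,\emptyset)\in D$ for all $\bar c\in A$; a $D$-model is a model whose universe is a $D$-set. $S_D(A)$ is the set of complete types $p$ over $A$ (in finitely many variables) such that $A\cup\bar c$ is a $D$-set whenever $\bar c\models p$. A $D$-model $M$ is $(D,\lambda)$-homogeneous if it realizes every $p\in S_D(A)$ with $A\subseteq M$, $|A|<\lambda$. Standing hypothesis: $\mathfrak{C}$ is a fixed $(D,\chi)$-homogeneous model (of cardinality at least $\chi$), where $\chi$ is larger than all cardinals considered; all $D$-sets and $D$-models other than $\mathfrak C$ are subsets (elementary submodels) of $\mathfrak C$ of cardinality less than $\chi$ (in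 particular the set $A$ in the claim). Rank. Let $A\subseteq\mathfrak C$. For a set of formulas $p(\bar x,\bar b)$ with parameters in a finite $\bar b\in A$, define $R_A[p]\ge\alpha$ by induction: $R_A[p]\ge0$ if $p$ is realized in $\mathfrak C$; for limit $\delta$, $R_A[p]\ge\delta$ if $R_A[p]\ge\alpha$ for all $\alpha<\delta$; $R_A[p]\ge\alpha+1$ if (a) there are $\bar a\in A$ and a formula $\phi(\bar x,\bar y)$ with $R_A[p\cup\{\phi(\bar x,\bar a)\}]\ge\alpha$ and $R_A[p\cup\{\neg\phi(\bar x,\bar a)\}]\ge\alpha$, and (b) for every $\bar a\in A$ there is $q(\bar x,\bar y)\in D$ with $R_A[p\cup q(\bar x,\bar a)]\ge\alpha$. $R_A[p]=-1$ if $p$ is not realized in $\mathfrak C$; $R_A[p]=\alpha$ if $R_A[p]\ge\alpha$ but not $R_A[p]\ge\alpha+1$; $R_A[p]=\infty$ if $R_A[p]\ge\alpha$ for all ordinals $\alpha$. For arbitrary $p$ over $A$, $R_A[p]=\min\{R_A[q]: q\subseteq p\restriction B,\ B\subseteq\operatorname{dom}(p)\text{ finite}\}$. $D$ is totally transcendental if $R_A[p]<\infty$ for every $A\subseteq\mathfrak C$ and every type $p$ over $A$. Isolation and prime models. $p\in S_D(A)$ is $D^s_\mu$-isolated over $B\subseteq A$, $|B|<\mu$, if every $q\in S_D(A)$ extending $p\restriction B$ equals $p$; it is $D^s_\mu$-isolated if it is so over some such $B$. A $(D,\mu)$-construction of $C$ over $A$ is a sequence $\{\langle a_i,A_i,B_i\rangle: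 i<\alpha\}$ with $C=A\cup\{a_i: i<\alpha\}$, $A_i=A\cup\{a_j: j<i\}$, $B_i\subseteq A_i$, $|B_i|<\mu$, and $\operatorname{tp}(a_i,A_i)\in S_D(A_i)$ $D^s_\mu$-isolated over $B_i$. $M$ is $D^s_\mu$-constructible over $A$ if there is a $(D,\mu)$-construction of $M$ over $A$; $M$ is $D^s_\mu$-primary over $A$ if it is $D^s_\mu$-constructible over $A$ and $(D,\mu)$-homogeneous. $M\supseteq A$ is $D^s_\mu$-prime over $A$ if $M$ is $(D,\mu)$-homogeneous and for every $(D,\mu)$-homogeneous $N\supseteq A$ there is an elementary map $f:M\to N$ with $f\restriction A=\mathrm{id}_A$.
   Formalization: The equality |M| = |A|+|T|+|D|+μ, false in general (e.g. ℵ₁ empty unary predicates on an infinite set, A empty, μ = ℵ₀), is replaced by |A|+|D'|+μ ≤ |M| ≤ |A|+|T|+|D|+μ, where D' is the set of types of D realized in 𝔠. *)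

(* Defs.v *)
From mathcomp Require Import all_boot.
From mathcomp Require Import boolp classical_sets functions cardinality wochoice.

Set Implicit Arguments.
Unset Strict Implicit.
Unset Printing Implicit Defensive.

Local Open Scope classical_set_scope.
Local Open Scope card_scope.

(* Cardinals are represented by types or sets, compared with [#<=]. *)
Definition card_lt (X Y : Type) (A : set X) (B : set Y) : Prop :=
  (A #<= B) /\ ~ (B #<= A).
Notation "A '#<' B" := (card_lt A B) (at level 79) : card_scope.

Definition card_add (X Y : Type) (A : set X) (B : set Y) : set (X + Y) :=
  (inl @` A) `|` (inr @` B).
Notation "A '#+' B" := (card_add A B) (at level 50, left associativity)
  : card_scope.

Record language := Language {
  lfun : Type; fun_ar : lfun -> nat;
  lrel : Type; rel_ar : lrel -> nat }.

Inductive term (L : language) (V : Type) : Type :=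
| Var of V
| App (f : lfun L) of ('I_(fun_ar f) -> term L V).

(* [fmla L V]: L-formulas with free variables in V; [Ex] binds [None]. *)
Inductive fmla (L : language) (V : Type) : Type :=
| Eq of term L V & term L V
| Rel (r : lrel L) of ('I_(rel_ar r) -> term L V)
| Not of fmla L V
| And of fmla L V & fmla L V
| Ex of fmla L (option V).

Fixpoint tmap (L : language) (V W : Type) (s : V -> W) (t : term L V) :
    term L W :=
  match t with
  | Var x => Var L (s x)
  | App f ts => App (fun i => tmap s (ts i))
  end.

Fixpoint fmap (L : language) (V W : Type) (s : V -> W) (phi : fmla L V) :
    fmla L W :=
  match phi with
  | Eq t u => Eq (tmap s t) (tmap s u)
  | Rel r ts => Rel (fun i => tmap s (ts i))
  | Not f => Not (fmap s f)
  | And f g => And (fmap s f) (fmap s g)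
  | Ex f => Ex (fmap (omap s) f)
  end.

Fixpoint tvars (L : language) (V : Type) (t : term L V) : set V :=
  match t with
  | Var x => [set x]
  | App f ts => [set x | exists i, tvars (ts i) x]
  end.

Fixpoint free (L : language) (V : Type) (phi : fmla L V) : set V :=
  match phi with
  | Eq t u => tvars t `|` tvars u
  | Rel r ts => [set x | exists i, tvars (ts i) x]
  | Not f => free f
  | And f g => free f `|` free g
  | Ex f => [set x | free f (Some x)]
  end.

Record interp (L : language) (U : Type) := Interp {
  ifun : forall f : lfun L, ('I_(fun_ar f) -> U) -> U;
  irel : forall r : lrel L, ('I_(rel_ar r) -> U) -> Prop }.

Fixpoint teval (L : language) (U : Type) (I : interp L U) (V : Type)
    (v : V -> U) (t : term L V) : U :=
  match t with
  | Var x => v x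
  | App f ts => ifun I (fun i => teval I v (ts i))
  end.

Fixpoint sat (L : language) (U : Type) (I : interp L U) (V : Type)
    (v : V -> U) (phi : fmla L V) : Prop :=
  match phi with
  | Eq t u => teval I v t = teval I v u
  | Rel r ts => irel I (fun i => teval I v (ts i))
  | Not f => ~ sat I v f
  | And f g => sat I v f /\ sat I v g
  | Ex f => exists x, sat I (fun o => if o is Some y then v y else x) f
  end.

Definition theory (L : language) := set (fmla L 'I_0).

Definition is_model (L : language) (T : theory L) (U : Type)
    (I : interp L U) : Prop :=
  inhabited U /\ forall phi (v : 'I_0 -> U), T phi -> sat I v phi.

(* |T| is the number of L(T)-formulas, with variables indexed by nat. *)
Definition formulas (L : language) (T : theory L) : set (fmla L nat) := setT.

(* tp(c, emptyset), as a set of parameter-free formulas *)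
Definition tp0 (L : language) (U : Type) (I : interp L U) (n : nat)
    (c : 'I_n -> U) : set (fmla L 'I_n) := [set phi | sat I c phi].

Definition DT (L : language) (T : theory L) (n : nat) :
    set (set (fmla L 'I_n)) :=
  [set p | exists (U : Type) (I : interp L U) (c : 'I_n -> U),
             is_model T I /\ p = tp0 I c].

(* A set D of types over the empty set is given by its n-types for each n;
   [total_set D] is the set of all of them, used for |D|. *)
Definition total_set (L : language) (D : forall n, set (set (fmla L 'I_n))) :
    set {n : nat & set (fmla L 'I_n)} := [set q | D (tag q) (tagged q)].

(* Ordinals, as well-founded trees.  [OSup I i0 f] is the least upper bound
   of the family f, whose index type is inhabited by i0 (so that it is not 0). *)
Inductive ordinal_tree : Type :=
| OZero
| OSucc of ordinal_tree
| OSup (I : Type) of I & (I -> ordinal_tree).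

Section FiniteDiagram.

(* U and I are the universe and the structure of the monster model. *)
Variables (L : language) (U : Type) (I : interp L U).

(* inl: free variables; inr: parameters *)
Definition pfmla (n : nat) := fmla L ('I_n + U).

Definition params (n : nat) (phi : pfmla n) : set U :=
  [set a | free phi (inr a)].

Definition dom (n : nat) (p : set (pfmla n)) : set U :=
  \bigcup_(phi in p) params phi.

Definition restr (n : nat) (p : set (pfmla n)) (B : set U) : set (pfmla n) :=
  [set phi | p phi /\ params phi `<=` B].

Definition psat (n : nat) (c : 'I_n -> U) (phi : pfmla n) : Prop :=
  sat I (fun z => match z with inl i => c i | inr a => a end) phi.

Definition realizes (n : nat) (c : 'I_n -> U) (p : set (pfmla n)) : Prop :=
  forall phi, p phi -> psat c phi.

Definition consistent (n : nat) (p : set (pfmla n)) : Prop :=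
  forall q, finite_set q -> q `<=` p -> exists c, realizes c q.

Definition tp (n : nat) (c : 'I_n -> U) (A : set U) : set (pfmla n) :=
  [set phi | params phi `<=` A /\ psat c phi].

Definition complete_type (A : set U) (n : nat) (p : set (pfmla n)) : Prop :=
  [/\ dom p `<=` A, consistent p &
      forall phi, params phi `<=` A -> p phi \/ p (Not phi)].

Definition saturated : Prop :=
  forall (A : set U) (n : nat) (p : set (pfmla n)),
    A #< [set: U] -> dom p `<=` A -> consistent p -> exists c, realizes c p.

Definition elementary_submodel (N : set U) : Prop :=
  exists J : interp L {x : U | N x},
    forall n (phi : fmla L 'I_n) (v : 'I_n -> {x : U | N x}),
      sat J v phi <-> sat I (fun i => sval (v i)) phi.

(* A partial map with domain M is given by a total function, used only on M. *)
Definition elementary_map (M : set U) (f : U -> U) : Prop :=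
  forall n (phi : fmla L 'I_n) (c : 'I_n -> U), (forall i, M (c i)) ->
    sat I c phi <-> sat I (f \o c) phi.

(* phi(x, y) |-> phi(x, a) *)
Definition inst (n m : nat) (a : 'I_m -> U) (phi : fmla L 'I_(n + m)) :
    pfmla n :=
  fmap (fun i => match fintype.split i with inl j => inl j | inr k => inr (a k) end)
    phi.

Variables (D : forall n, set (set (fmla L 'I_n))) (chi : Type) (C : set U).

Definition D_set (A : set U) : Prop :=
  forall n (c : 'I_n -> U), (forall i, A (c i)) -> D (tp0 I c).

Definition S_D (A : set U) (n : nat) (p : set (pfmla n)) : Prop :=
  complete_type A p /\ forall c, realizes c p -> D_set (A `|` range c).

(* All D-models other than C are submodels of C of cardinality < chi. *)
Definition D_model (M : set U) : Prop :=
  [/\ elementary_submodel M, D_set M &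
      M = C \/ (M `<=` C /\ M #< [set: chi])].

(* The cardinal lambda is that of the type lam; similarly for mu below. *)
Definition homogeneous (lam : Type) (M : set U) : Prop :=
  D_model M /\
  forall (A : set U) (n : nat) (p : set (pfmla n)),
    A `<=` M -> A #< [set: lam] -> S_D A p ->
    exists c : 'I_n -> U, (forall i, M (c i)) /\ realizes c p.

(* R_A[p] >= alpha for p with finitely many parameters, all in A.  At an OSup
   which is in fact a maximum, the clause for suprema agrees with the others,
   because R_A[p] >= alpha + 1 implies R_A[p] >= alpha. *)
Fixpoint rank_fin_ge (A : set U) (n : nat) (alpha : ordinal_tree)
    (p : set (pfmla n)) : Prop :=
  match alpha with
  | OZero => exists c : 'I_n -> U, (forall i, C (c i)) /\ realizes c p
  | OSucc beta =>
      (exists m (a : 'I_m -> U) (phi : fmla L 'I_(n + m)),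
         [/\ forall i, A (a i),
             rank_fin_ge A beta (p `|` [set inst a phi]) &
             rank_fin_ge A beta (p `|` [set Not (inst a phi)])]) /\
      (forall m (a : 'I_m -> U), (forall i, A (a i)) ->
         exists2 q : set (fmla L 'I_(n + m)), D q &
           rank_fin_ge A beta (p `|` (inst a @` q)))
  | OSup _ _ f => forall k, rank_fin_ge A (f k) p
  end.

(* R_A[p] >= alpha for arbitrary p over A: R_A[p] is the minimum of the
   R_A[q], for q included in p|B and B a finite subset of dom(p). *)
Definition rank_ge (A : set U) (n : nat) (p : set (pfmla n))
    (alpha : ordinal_tree) : Prop :=
  forall (B : set U) (q : set (pfmla n)),
    finite_set B -> B `<=` dom p -> q `<=` restr p B -> rank_fin_ge A alpha q.

Definition rank_infinite (A : set U) (n : nat) (p : set (pfmla n)) : Prop :=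
  forall alpha, rank_ge A p alpha.

Definition totally_transcendental : Prop :=
  forall (A : set U) (n : nat) (p : set (pfmla n)),
    A `<=` C -> dom p `<=` A -> consistent p -> ~ rank_infinite A p.

Definition isolated_over (mu : Type) (A B : set U) (n : nat)
    (p : set (pfmla n)) : Prop :=
  [/\ S_D A p, B `<=` A, B #< [set: mu] &
      forall q, S_D A q -> restr p B `<=` q -> q = p].

(* A construction is indexed by an arbitrary well-ordered type (K, le) in
   place of an ordinal. *)
Definition constructible (mu : Type) (A M : set U) : Prop :=
  exists (K : Type) (le : rel K) (a : K -> U) (B : K -> set U),
    let A_ i := A `|` [set a j | j in [set j | le j i /\ j <> i]] in
    [/\ well_order le,
        M = A `|` range a &
        forall i, isolated_over mu (A_ i) (B i)
                    (tp (fun _ : 'I_1 => a i) (A_ i))].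

Definition primary (mu : Type) (A M : set U) : Prop :=
  constructible mu A M /\ homogeneous mu M.

Definition prime_over (mu : Type) (A M : set U) : Prop :=
  [/\ A `<=` M, homogeneous mu M &
      forall N, homogeneous mu N -> A `<=` N ->
        exists f : U -> U,
          [/\ elementary_map M f, f @` M `<=` N & forall x, A x -> f x = x]].

Definition realized (n : nat) : set (set (fmla L 'I_n)) :=
  [set p | D p /\ exists c : 'I_n -> U, (forall i, C (c i)) /\ p = tp0 I c].

End FiniteDiagram.

(* Main.v *)
From Stdlib Require List Eqdep_dec.
Require Import Defs.
From mathcomp Require Import all_boot.
From mathcomp Require Import boolp classical_sets functions cardinality wochoice.

(* Total transcendence enters through one principle: a family of types over
   finite sets in which every type can be split and extended consists of types
   of infinite rank, so it is empty (no_perfect_family).  It yields the density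
   of isolated types, the bound on the number of types, finite bases for types
   over omega-homogeneous sets in the sense of non-splitting, and the absence
   of the order property, hence the symmetry of independence.  The model is
   built in omega blocks of mu stages, each of which realizes all isolated
   types over what precedes it.  As mu may be singular, a subset B of M with
   |B| < mu need not lie in an early part of the construction; instead, a type
   p over M has a Morley sequence of length mu inside one block, and symmetry
   shows that each finite tuple of B is in the wrong position with respect to
   only finitely many of its elements, so one of them realizes p over B. *)

Set Implicit Arguments.
Unset Strict Implicit.
Unset Printing Implicit Defensive.

Local Open Scope classical_set_scope.
Local Open Scope card_scope.

(** * Infinite cardinals *)

(** Compactness does not respect [D]: a consistent type need not have a realization in [C]. So types
    are handled through realizations in [C] and are moved only by elementary maps, prolonged by
    homogeneity. Clause (b) of the rank is why each use of the principle must also prolong its types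
    over any finite set without leaving [C]. The finiteness of the set of wrong members comes from a
    tree. If a tuple were wrong for infinitely many members of the Morley sequence, omega further
    members generic over the tuple could be appended. The result is indiscernible as a set, so
    conjugates of the tuple realize every finite pattern of wrong and right positions: a binary tree
    of types over countably many members. The blocks have order type omega so that a finite tuple
    precedes some block, with infinitely many blocks left for the appended members. An infinite [B]
    with |B| < mu forces mu to be uncountable, which admits countable parameter sets in a stage; and
    the |B| finite tuples, excluding finitely many members each, cannot exhaust mu. *)

Lemma card_le_injP (X Y : Type) (A : set X) (y0 : Y) :
  A #<= [set: Y] <->
  exists f : X -> Y, forall a b, A a -> A b -> f a = f b -> a = b.
Proof.
elim/Ppointed: Y y0 => [Y y0|Y y0]; first by case: (no y0).
split=> [/pcard_injP[f fi]|[f fi]]; last apply/pcard_injP; exists f.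
  by move=> a b Aa Ab; apply: fi; rewrite inE.
by move=> a b; rewrite !inE; apply: fi.
Qed.

Lemma card_le_injT (X Y : Type) (f : X -> Y) :
  injective f -> [set: X] #<= [set: Y].
Proof.
move=> fi; have [[x _]|X0] := pselect ([set: X] !=set0).
  by apply/(card_le_injP _ (f x)); exists f => a b _ _; apply: fi.
have -> : [set: X] = set0 by apply/seteqP; split=> // x _; apply: X0; exists x.
exact: card_ge0.
Qed.

Lemma card_le_injTP (X Y : Type) : [set: X] #<= [set: Y] ->
  exists f : X -> Y, injective f.
Proof.
have [[y _]|Y0] := pselect ([set: Y] !=set0).
  by move=> /(card_le_injP _ y)[f fi]; exists f => a b; apply: fi.
have -> : [set: Y] = set0 by apply/seteqP; split=> // x _; apply: Y0; exists x.
move=> /card_le0P X0; have E (x : X) : False.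
  by have : [set: X] x by []; rewrite X0.
by exists (fun x => False_rect Y (E x)) => x; case: (E x).
Qed.

Lemma card_le_imageT (X Y : Type) (A : set X) (B : set Y) (f : Y -> X) :
  A `<=` f @` B -> A #<= B.
Proof. by move=> /subset_card_le/card_le_trans; apply; apply: card_image_le. Qed.

Lemma card_le_surjP (X Y : Type) (A : set X) (x0 : X) : A #<= [set: Y] ->
  exists f : Y -> X, forall x, A x -> exists y, f y = x.
Proof.
elim/Ppointed: X A x0 => [X A x0|X A x0].
  by case: (no x0).
by move=> /pcard_surjP[g gs]; exists g => x /gs[y _ <-]; exists y.
Qed.

(** Zorn's lemma on graphs of partial injections: a maximal one is total on one side, since
    otherwise a pair of missing points could be adjoined. *)
Lemma card_le_total (X Y : Type) : [set: X] #<= [set: Y] \/ [set: Y] #<= [set: X].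
Proof.
pose P (F : set (X * Y)) := forall p q, F p -> F q -> (p.1 = q.1 <-> p.2 = q.2).
have [|E [PE Emax]] := @Zorn_bigcup _ P.
  move=> F FP Ftot p q [G FG Gp] [H FH Hq].
  have [GH|HG] := Ftot _ _ FG FH.
    by apply: (FP _ FH) => //; apply: GH.
  by apply: (FP _ FG) => //; apply: HG.
have [Xall|/existsNP[x Ex]] := pselect (forall x, exists y, E (x, y)).
  have [f Ef] := choice Xall; left; apply: (@card_le_injT _ _ f) => a b fab.
  by have [_] := PE _ _ (Ef a) (Ef b); apply.
have [Yall|/existsNP[y Ey]] := pselect (forall y, exists x, E (x, y)).
  have [f Ef] := choice Yall; right; apply: (@card_le_injT _ _ f) => a b fab.
  by have [+ _] := PE _ _ (Ef a) (Ef b); apply.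
case: (Emax (E `|` [set (x, y)])).
  split; first by move=> p Ep; left.
  by move=> /(_ (x, y) (or_intror erefl)) Exy; apply: Ex; exists y.
move=> [p1 p2] [q1 q2] /= [Ep|[-> ->]] [Eq|[-> ->]] //.
- exact: (PE _ _ Ep Eq).
- by split=> e; [case: Ex|case: Ey]; rewrite -e; eexists; apply: Ep.
- by split=> e; [case: Ex|case: Ey]; rewrite e; eexists; apply: Eq.
Qed.

Lemma card_le_total_set (X Y : Type) (A : set X) (B : set Y) : A #<= B \/ B #<= A.
Proof.
have [AB|BA] := card_le_total A B; [left|right].
  by rewrite -(card_le_eql (card_setT A)) -(card_le_eqr (card_setT B)).
by rewrite -(card_le_eql (card_setT B)) -(card_le_eqr (card_setT A)).
Qed.

Section CardSquare.

Variable X : Type.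
Hypothesis X_inf : infinite_set [set: X].

Let fld (F : set (X * X * X)) : set X := [set x | exists y z, F (x, y, z)].

Let good (F : set (X * X * X)) : Prop :=
  [/\ forall p q, F p -> F q -> (p.1 = q.1 <-> p.2 = q.2),
      forall x y, fld F x -> fld F y -> exists z, F (x, y, z) &
      forall x y z, F (x, y, z) -> [/\ fld F x, fld F y & fld F z]].

(* Zorn's lemma on injections A * A -> A extending one with A countable: the
   domain of a maximal one has the cardinality of X. *)
Lemma card_squareT : [set: X * X] #<= [set: X].
Proof.
have /infiniteP/card_le_injTP[i i_inj] := X_inf.
pose F0 : set (X * X * X) :=
  [set t | exists m n, t = (i m, i n, i (pickle (m, n)))].
have fld0 x : fld F0 x <-> exists n, x = i n.
  split=> [[y [z [m [n [-> _ _]]]]]|[n ->]]; first by exists m.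
  by exists (i n), (i (pickle (n, n))), n, n.
have good0 : good F0.
  split.
  - move=> _ _ [m [n ->]] [m' [n' ->]] /=; split=> [[/i_inj -> /i_inj ->]//|].
    by move=> /i_inj /(pcan_inj (@pickleK _)) [-> ->].
  - move=> x y /fld0[m ->] /fld0[n ->].
    by exists (i (pickle (m, n))), m, n.
  - by move=> x y z [m [n [-> -> ->]]]; split; apply/fld0; eexists.
(* [F0] is adjoined in the predicate rather than required in [F], so that the empty chain is
   covered. *)
have [|E [gE Emax]] := @Zorn_bigcup _ [set F | good (F `|` F0)].
  move=> F Fg Ftot; rewrite /=; set V := _ `|` F0.
  have sub2 t1 t2 : V t1 -> V t2 ->
      exists G, [/\ good G, G `<=` V, G t1 & G t2].
    have sV G : F G -> G `|` F0 `<=` V.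
      by move=> FG t [Gt|]; [left; exists G|right].
    move=> [[G FG Gt1]|t1F] [[H FH Ht2]|t2F].
    - have [GH|HG] := Ftot _ _ FG FH.
        by exists (H `|` F0); split; [exact: Fg|exact: sV|left; apply: GH|left].
      by exists (G `|` F0); split; [exact: Fg|exact: sV|left|left; apply: HG].
    - by exists (G `|` F0); split; [exact: Fg|exact: sV|left|right].
    - by exists (H `|` F0); split; [exact: Fg|exact: sV|right|left].
    - by exists F0; split=> // t; right.
  have fldS G : G `<=` V -> fld G `<=` fld V.
    by move=> GV x [y [z /GV]]; exists y, z.
  split.
  - by move=> p q Vp Vq; have [G [[gG _ _] _ ? ?]] := sub2 _ _ Vp Vq; apply: gG.
  - move=> x y [x1 [x2 Vx]] [y1 [y2 Vy]].
    have [G [[_ gG _] GV Gx Gy]] := sub2 _ _ Vx Vy.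
    have [||z Gz] := gG x y; [by exists x1, x2|by exists y1, y2|].
    by exists z; apply: GV.
  - move=> x y z Vt; have [G [[_ _ gG] GV Gt _]] := sub2 _ _ Vt Vt.
    by have [? ? ?] := gG _ _ _ Gt; split; apply: fldS GV _ _.
set G := E `|` F0 in gE; have [Gf Gt Gc] := gE; pose A := fld G.
have Ai n : A (i n).
  by have /fld0[y [z Fz]] : exists m, i n = i m := ex_intro _ n erefl;
     exists y, z; right.
have /choice[f0 f0P] (p : X * X) : exists z, A p.1 -> A p.2 -> G (p, z).
  have [[A1 A2]|nA] := pselect (A p.1 /\ A p.2); last first.
    by exists (i 0) => A1 A2; case: nA.
  by have [z Gz] := Gt _ _ A1 A2; exists z; rewrite [p]surjective_pairing.
pose f x y := f0 (x, y).
have fA x y : A x -> A y -> A (f x y).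
  by move=> Ax Ay; have /Gc[] := f0P (x, y) Ax Ay.
have f_inj x y x' y' : A x -> A y -> A x' -> A y' ->
    f x y = f x' y' -> x = x' /\ y = y'.
  move=> Ax Ay Ax' Ay' e.
  by have [_ /(_ e)[-> ->]] := Gf _ _ (f0P (x, y) Ax Ay) (f0P (x', y') Ax' Ay').
have i01 m n : m != n -> i m <> i n by move=> /eqP mn /i_inj.
(* If the complement of [A] injects into [A], so does [X], by two copies of [A] tagged with [i 0]
   and [i 1]. *)
have [CA|AC] := card_le_total_set (~` A) A.
  have /(card_le_trans CA)/(card_le_injP _ (i 0))[g0 _] := card_leT A.
  have [g gA g_inj] : exists2 g : X -> X, forall x, ~ A x -> A (g x) &
      forall x y, ~ A x -> ~ A y -> g x = g y -> x = y.
    move: CA; rewrite -(card_le_eqr (card_setT A)).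
    move=> /(card_le_injP _ (SigSub (mem_set (Ai 0))))[g g_inj].
    exists (fun x => \val (g x)) => [x _|x y nx ny /val_inj]; last exact: g_inj.
    exact: set_valP.
  pose h x := if pselect (A x) then f (i 0) x else f (i 1) (g x).
  have hA x : A (h x) by rewrite /h; case: pselect => Ax; apply: fA; auto.
  have h_inj : injective h.
    move=> x y; rewrite /h; case: pselect => Ax; case: pselect => Ay;
    move=> /f_inj[]; auto.
    - by move=> /i01 [].
    - by move=> /i01 [].
  apply: (@card_le_injT _ _ (fun p => f (h p.1) (h p.2))) => -[x y] [x' y'] /=.
  by move=> /f_inj[]// /h_inj -> /h_inj ->.
have [g gA g_inj] : exists2 g : X -> X, forall x, A x -> ~ A (g x) &
    forall x y, A x -> A y -> g x = g y -> x = y.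
  have [x0 nx0] : exists x0, ~ A x0.
    apply: contrapT => /forallNP allA; move: AC.
    suff -> : ~` A = set0.
      by move=> /card_le0P A0; have := Ai 0; rewrite A0.
    by apply/seteqP; split=> // x /= nAx; have := allA x.
  have nx0' : (~` A) x0 by [].
  move: AC; rewrite -(card_le_eqr (card_setT (~` A))).
  move=> /(card_le_injP _ (SigSub (mem_set nx0')))[g g_inj].
  exists (fun x => \val (g x)) => [x _|x y nx ny /val_inj]; last exact: g_inj.
  by have : (~` A) (\val (g x)) := set_valP _.
(* Otherwise [A] has a disjoint copy under [g], and [f] extends to the union against maximality:
   pairs not inside [A] are coded in the copy, with a tag [c] that records the sides of their
   entries. *)
pose e (b : bool) a := if b then g a else a.
have e_inj b b' a a' : A a -> A a' -> e b a = e b' a' -> b = b' /\ a = a'.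
  move=> Aa Aa'; case: b; case: b' => /=.
  - by move=> /g_inj ->.
  - by move=> ga; have := gA _ Aa; rewrite ga.
  - by move=> ga; have := gA _ Aa'; rewrite -ga.
  - by move=> ->.
pose c (b b' : bool) := i (b + b'.*2).
have c_inj b1 b2 b1' b2' : c b1 b2 = c b1' b2' -> b1 = b1' /\ b2 = b2'.
  by move=> /i_inj; case: b1; case: b2; case: b1'; case: b2'.
have cA b b' : A (c b b') by apply: Ai.
pose N : set (X * X * X) := [set t | exists b1 b2 a1 a2,
  [/\ b1 || b2, A a1, A a2 &
      t = (e b1 a1, e b2 a2, g (f (c b1 b2) (f a1 a2)))]].
have NA x y z : N (x, y, z) -> ~ A z /\ ~ (A x /\ A y).
  move=> [b1 [b2 [a1 [a2 [b12 A1 A2 [-> -> ->]]]]]]; split.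
    by apply: gA; apply: (fA) => //; apply: (fA).
  have [g1 g2] := (gA _ A1, gA _ A2).
  by case: b1 b12 => [_ [/g1]|] //; case: b2 => // _ [_ /g2].
have GA x y z : G (x, y, z) -> [/\ A x, A y & A z] by apply: Gc.
have EG : E `|` N `|` F0 = G `|` N.
  by apply/seteqP; split=> t; rewrite /G; [case=> [[]|]|case=> [[]|]];
     rewrite /setU /=; tauto.
have fldGN x : fld (G `|` N) x <-> exists b a, A a /\ x = e b a.
  split=> [[y [z [/GA[Ax _ _]|]]]|[b [a [Aa ->]]]].
  - by exists false, x.
  - by move=> [b1 [b2 [a1 [a2 [_ A1 _ [-> _ _]]]]]]; exists b1, a1.
  exists (e true a), (g (f (c b true) (f a a))); right.
  by exists b, true, a, a; rewrite orbT.
case: (Emax (E `|` N)).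
  split; first by move=> t; left.
  move=> NE.
  have Et : E (g (i 0), g (i 0), g (f (c true true) (f (i 0) (i 0)))).
    by apply: NE; right; exists true, true, (i 0), (i 0).
  have /GA[+ _ _] : G (g (i 0), g (i 0), g (f (c true true) (f (i 0) (i 0)))).
    by left.
  exact/gA.
rewrite /= EG; split.
- move=> [[x y] z] [[x' y'] z'] /= [Gp|Np] [Gq|Nq].
  + exact: (Gf _ _ Gp Gq).
  + have [Ax Ay Az] := GA _ _ _ Gp; have [nz nxy] := NA _ _ _ Nq.
    by split=> [[ex ey]|ez]; [case: nxy; rewrite -ex -ey|case: nz; rewrite -ez].
  + have [Ax Ay Az] := GA _ _ _ Gq; have [nz nxy] := NA _ _ _ Np.
    by split=> [[ex ey]|ez]; [case: nxy; rewrite ex ey|case: nz; rewrite ez].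
  + move: Np Nq => [b1 [b2 [a1 [a2 [_ A1 A2 [-> -> ->]]]]]].
    move=> [b1' [b2' [a1' [a2' [_ A1' A2' [-> -> ->]]]]]].
    split=> [[/e_inj[]// -> -> /e_inj[]// -> -> //]|].
    have fA1 := fA _ _ A1 A2; have fA1' := fA _ _ A1' A2'.
    move=> /g_inj; case/(_ (fA _ _ (cA b1 b2) fA1) (fA _ _ (cA b1' b2') fA1')).
    by move=> /f_inj[]// /c_inj[-> ->] /f_inj[]// -> ->.
- move=> x y /fldGN[b [a [Aa ->]]] /fldGN[b' [a' [Aa' ->]]].
  have [bb|nbb] := boolP (b || b').
    by exists (g (f (c b b') (f a a'))); right; exists b, b', a, a'.
  have [z Gz] := Gt _ _ Aa Aa'; exists z; left.
  by move: nbb; rewrite negb_or => /andP[/negbTE -> /negbTE ->].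
- move=> x y z [/GA[Ax Ay Az]|].
    by split; apply/fldGN; exists false; [exists x|exists y|exists z].
  move=> [b1 [b2 [a1 [a2 [_ A1 A2 [-> -> ->]]]]]].
  split; apply/fldGN.
  + by exists b1, a1.
  + by exists b2, a2.
  + by exists true, (f (c b1 b2) (f a1 a2)); split=> //; apply: (fA) => //; apply: (fA).
Qed.

(** The folded pairing is injective only among sequences of equal length, so the length is coded
    beside it. *)
Lemma card_seqT : [set: seq X] #<= [set: X].
Proof.
have /card_le_injTP[pr pr_inj] := card_squareT.
have /infiniteP/card_le_injTP[i i_inj] := X_inf.
pose code s := foldr (fun x y => pr (x, y)) (i 0) s.
apply: (@card_le_injT _ _ (fun s => pr (i (size s), code s))) => s t /pr_inj[].
move=> /i_inj; elim: s t => [|x s IH] [|y t] //= [st] /pr_inj[-> e].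
by rewrite (IH t st e).
Qed.

End CardSquare.

Lemma card_prodT (X Y Z : Type) : infinite_set [set: Z] ->
  [set: X] #<= [set: Z] -> [set: Y] #<= [set: Z] -> [set: X * Y] #<= [set: Z].
Proof.
move=> /card_squareT/card_le_injTP[p p_inj].
move=> /card_le_injTP[f f_inj] /card_le_injTP[g g_inj].
apply: (@card_le_injT _ _ (fun u => p (f u.1, g u.2))) => -[x y] [x' y'] /=.
by move=> /p_inj[/f_inj -> /g_inj ->].
Qed.

Lemma card_unionT (X Y : Type) (A B : set X) : infinite_set [set: Y] ->
  A #<= [set: Y] -> B #<= [set: Y] -> A `|` B #<= [set: Y].
Proof.
move=> Yinf; have [y _] := infinite_setN0 Yinf.
have /infiniteP/card_le_injTP[i i_inj] := Yinf.
move=> /(card_le_injP _ y)[f f_inj] /(card_le_injP _ y)[g g_inj].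
have /card_le_injTP[p p_inj] := card_squareT Yinf.
apply/(card_le_injP _ y).
exists (fun x => if pselect (A x) then p (i 0, f x) else p (i 1, g x)).
move=> a b; case: pselect => Aa; case: pselect => Ab.
- by move=> _ _ /p_inj[]; apply: f_inj.
- by move=> _ _ /p_inj[/i_inj].
- by move=> _ _ /p_inj[/i_inj].
- by move=> [//|Ba] [//|Bb] /p_inj[]; apply: g_inj.
Qed.

Lemma card_le_addl (X Y : Type) (A : set X) (B : set Y) : A #<= A #+ B.
Proof.
rewrite -(card_le_eql (@inj_card_eq _ _ A (@inl X Y) _)); last by move=> x y _ _ [].
by apply: subset_card_le => x Ax; left.
Qed.

Lemma card_le_addr (X Y : Type) (A : set X) (B : set Y) : B #<= A #+ B.
Proof.
rewrite -(card_le_eql (@inj_card_eq _ _ B (@inr X Y) _)); last by move=> x y _ _ [].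
by apply: subset_card_le => x Bx; right.
Qed.

Lemma card_add_leT (X Y Z : Type) (A : set X) (B : set Y) :
  infinite_set [set: Z] -> A #<= [set: Z] -> B #<= [set: Z] -> A #+ B #<= [set: Z].
Proof.
move=> Zinf AZ BZ; apply: card_unionT => //.
  exact: card_le_trans (card_image_le _ _) AZ.
exact: card_le_trans (card_image_le _ _) BZ.
Qed.

Lemma card_lt_le (X Y Z : Type) (A : set X) (B : set Y) (E : set Z) :
  A #<= B -> B #< E -> A #< E.
Proof.
move=> AB [BE EB]; split; first exact: card_le_trans AB BE.
by move=> EA; apply: EB; apply: card_le_trans EA AB.
Qed.

Lemma card_lt_le_r (X Y Z : Type) (A : set X) (B : set Y) (E : set Z) :
  A #< B -> B #<= E -> A #< E.
Proof.
move=> [AB BA] BE; split; first exact: card_le_trans AB BE.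
by move=> EA; apply: BA; apply: card_le_trans BE EA.
Qed.

Lemma finite_card_lt (X Y : Type) (A : set X) : infinite_set [set: Y] ->
  finite_set A -> A #< [set: Y].
Proof.
move=> Yinf Afin; have nle : ~ ([set: Y] #<= A).
  by move=> /card_le_finite/(_ Afin).
by split=> //; have [] := card_le_total_set A [set: Y].
Qed.

Lemma card_lt_union (X Y : Type) (A B : set X) : infinite_set [set: Y] ->
  A #< [set: Y] -> B #< [set: Y] -> A `|` B #< [set: Y].
Proof.
move=> Yinf; wlog AB : A B / A #<= B.
  move=> H AY BY; have [AB|BA] := card_le_total_set A B; first exact: H.
  by rewrite setUC; apply: H.
move=> AY BY; have [Bfin|Binf] := pselect (finite_set B).
  by apply: finite_card_lt => //; rewrite finite_setU; split=> //;
     apply: card_le_finite AB Bfin.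
apply: card_lt_le BY; have BT : B #<= [set: B] by rewrite (card_le_eqr (card_setT B)).
rewrite -(card_le_eqr (card_setT B)); apply: card_unionT => //.
- by apply: contra_not Binf; apply: card_le_finite.
- exact: card_le_trans AB BT.
Qed.

(** If some initial segment has the cardinality of [X], take the least [z] with such a segment and
    pull the order back along an injection of [X] into it; minimality of [z] makes all new segments
    smaller. *)
Lemma initial_well_order (X : Type) : exists R : X -> X -> Prop,
  [/\ forall A : set X, A !=set0 -> exists2 z, A z & forall x, A x -> ~ R x z,
      forall x y z, R x y -> R y z -> R x z,
      forall x y, [\/ R x y, x = y | R y x],
      forall x, ~ R x x &
      forall x, [set y | R y x] #< [set: X]].
Proof.
have [le le_wo] := @well_ordering_principle {classic X}.
have minP (A : set X) : A !=set0 -> exists2 z, A z & forall x, A x -> le z x.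
  move=> [x Ax]; have [|z [[zA zmin] _]] := le_wo (fun x : {classic X} => `[< A x >]).
    by exists x; apply/asboolP.
  exists z; first exact/asboolP.
  by move=> y Ay; apply: zmin; apply/asboolP.
have le_total x y : le x y \/ le y x.
  have [|z [->|->] zmin] := minP [set z | z = x \/ z = y].
  - by exists x; left.
  - by left; apply: zmin; right.
  - by right; apply: zmin; left.
have le_anti (x y : X) : le x y -> le y x -> x = y.
  move=> xy yx.
  have [|z [_ U]] := le_wo (fun z : {classic X} => `[< z = x \/ z = y >]).
    by exists x; apply/asboolP; left.
  have <- : z = x.
    apply: U; split; first by apply/asboolP; left.
    by move=> w /asboolP[->|->] //; case: (le_total x x).
  apply: U; split; first by apply/asboolP; right.
  by move=> w /asboolP[->|->] //; case: (le_total y y).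
pose R (x y : X) : Prop := ~ le y x.
have R_wf (A : set X) : A !=set0 -> exists2 z, A z & forall x, A x -> ~ R x z.
  by move=> /minP[z Az zm]; exists z => // x /zm lezx; apply.
have R_trans x y z : R x y -> R y z -> R x z.
  move=> xy yz zx.
  have [|w [->|[->|->]] wmin] := minP [set w | w = x \/ w = y \/ w = z].
  - by exists x; left.
  - have xy' : le x y by apply: wmin; right; left.
    have xz' : le x z by apply: wmin; right; right.
    have e := le_anti _ _ xz' zx; move: yz; rewrite /R -e; exact.
  - by apply: xy; apply: wmin; left.
  - by apply: yz; apply: wmin; right; left.
have R_irr x : ~ R x x by apply; have [] := le_total x x.
have R_tot x y : [\/ R x y, x = y | R y x].
  have [yx|] := pselect (le y x); last by constructor 1.
  have [xy|] := pselect (le x y); last by constructor 3.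
  by constructor 2; apply: le_anti.
have [allx|/existsNP[x Bx]] := pselect (forall x, [set y | R y x] #< [set: X]).
  by exists R.
have [z Bz zmin] := R_wf [set x | ~ ([set y | R y x] #< [set: X])] (ex_intro _ x Bx).
have : [set: X] #<= [set y | R y z].
  by apply: contrapT => nle; apply: Bz; split=> //; apply: card_leT.
rewrite -(card_le_eqr (card_setT _)) => /card_le_injTP[f0 f0_inj].
pose f a : X := \val (f0 a).
have f_inj : injective f by move=> a b /val_inj/f0_inj.
have fz a : R (f a) z by apply: (set_valP (f0 a)).
exists (fun x y => R (f x) (f y)); split.
- move=> A [a Aa]; have [|_ [w Aw <-] wm] := R_wf (f @` A).
    by exists (f a), a.
  by exists w => // v Av; apply: wm; exists v.
- by move=> ? ? ?; apply: R_trans.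
- move=> u v; have [|/f_inj|] := R_tot (f u) (f v).
  + by constructor 1.
  + by constructor 2.
  + by constructor 3.
- by move=> u; apply: R_irr.
- move=> u; have /contrapT : ~ ~ ([set y | R y (f u)] #< [set: X]).
    by move=> /zmin; apply; apply: fz.
  apply: card_lt_le; rewrite -(card_le_eql (@inj_card_eq _ _ _ f _)).
    by apply: subset_card_le => _ [y ? <-].
  by move=> ? ? _ _; apply: f_inj.
Qed.

(** * Renaming and finite support of formulas *)

Lemma List_InP (T : eqType) (x : T) (s : seq T) : reflect (List.In x s) (x \in s).
Proof.
elim: s => [|y s IH] /=; first by right.
rewrite in_cons; by apply: (iffP orP) => [[/eqP ->|/IH]|[->|/IH]]; auto.
Qed.

Section Syntax.

Variables (L : language) (U : Type) (I : interp L U).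

Definition case_sum (A B T : Type) (f : A -> T) (g : B -> T) (z : A + B) : T :=
  match z with inl a => f a | inr b => g b end.

Lemma tmap_comp V W X (e : W -> X) (g : V -> W) (t : term L V) :
  tmap e (tmap g t) = tmap (e \o g) t.
Proof. by elim: t => //= f ts IH; congr App; apply/funext => i; apply: IH. Qed.

Lemma fmap_comp V W X (e : W -> X) (g : V -> W) (phi : fmla L V) :
  fmap e (fmap g phi) = fmap (e \o g) phi.
Proof.
elim: phi W X e g => {V} /= [V t u|V r ts|V f IH|V f IHf h IHh|V f IH] W X e g.
- by rewrite !tmap_comp.
- by congr Rel; apply/funext => i; rewrite tmap_comp.
- by rewrite IH.
- by rewrite IHf IHh.
- by rewrite IH; congr (Ex (fmap _ _)); apply/funext => -[].
Qed.

Lemma teval_tmap V W (e : V -> W) (v : W -> U) (t : term L V) :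
  teval I v (tmap e t) = teval I (v \o e) t.
Proof. by elim: t => //= f ts IH; congr ifun; apply/funext => i; apply: IH. Qed.

Lemma sat_fmap V W (e : V -> W) (v : W -> U) (phi : fmla L V) :
  sat I v (fmap e phi) <-> sat I (v \o e) phi.
Proof.
elim: phi W e v => {V} /= [V t u|V r ts|V f IH|V f IHf h IHh|V f IH] W e v.
- by rewrite !teval_tmap.
- by under eq_fun do rewrite teval_tmap.
- by rewrite IH.
- by rewrite IHf IHh.
- have E x : (fun o => if o is Some y then v y else x) \o omap e =
      (fun o => if o is Some y then v (e y) else x) by apply/funext => -[].
  by split=> -[x fx]; exists x; move: fx; rewrite IH E.
Qed.

Lemma tvars_tmap V W (e : V -> W) (t : term L V) y :
  tvars (tmap e t) y -> exists2 x, tvars t x & y = e x.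
Proof.
elim: t => [x ->|f ts IH [i H]] /=; first by exists x.
by have [x tx ->] := IH _ H; exists x => //; exists i.
Qed.

Lemma free_fmap V W (e : V -> W) (phi : fmla L V) y :
  free (fmap e phi) y -> exists2 x, free phi x & y = e x.
Proof.
elim: phi W e y => {V} /= [V t u|V r ts|V f IH|V f IHf h IHh|V f IH] W e y.
- by case=> H; have [x tx ->] := tvars_tmap H; exists x => //; [left|right].
- by case=> i H; have [x tx ->] := tvars_tmap H; exists x => //; exists i.
- exact: IH.
- by case=> H; [have [x fx ->] := IHf _ _ _ H|have [x fx ->] := IHh _ _ _ H];
    exists x => //; [left|right].
- by move=> H; have [[x|] fx //= [->]] := IH _ _ _ H; exists x.
Qed.

Lemma term_support V (t : term L V) : exists (J : finType) (e : J -> V) t',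
  tmap e t' = t /\ forall j, tvars t (e j).
Proof.
elim: t => [x|f ts IH].
  by exists unit, (fun=> x), (Var L tt).
have /choice[F FP] (i : 'I_(fun_ar f)) :
    exists F : {J : finType & ((J -> V) * term L J)%type},
      tmap (tagged F).1 (tagged F).2 = ts i /\
      forall j, tvars (ts i) ((tagged F).1 j).
  by have [J [e [t' H]]] := IH i; exists (existT _ J (e, t')).
pose J := {i : 'I_(fun_ar f) & tag (F i)}.
exists J, (fun j : J => (tagged (F (tag j))).1 (tagged j)).
exists (App (fun i => tmap (fun j => Tagged (fun i => tag (F i)) j : J)
                        (tagged (F i)).2)).
split=> [|[i j]] /=; last by exists i; have [_] := FP i; apply.
by congr App; apply/funext => i; rewrite tmap_comp; have [<- _] := FP i.
Qed.

(** Reduces formulas over any type of variables to finitely many, all of them free; elementarity,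
    stated for finite tuples, thereby applies to arbitrary assignments. *)
Lemma fmla_support V (phi : fmla L V) : exists (J : finType) (e : J -> V) psi,
  fmap e psi = phi /\ forall j, free phi (e j).
Proof.
elim: phi => {V} /= [V t u|V r ts|V f [J [e [psi [<- fe]]]]|
    V f [J1 [e1 [f' [<- fe1]]]] h [J2 [e2 [h' [<- fe2]]]]|
    V f [J [e [psi [<- fe]]]]].
- have [J1 [e1 [t' [<- te1]]]] := term_support t.
  have [J2 [e2 [u' [<- ue2]]]] := term_support u.
  exists (J1 + J2)%type, (case_sum e1 e2), (Eq (tmap inl t') (tmap inr u')).
  by split=> [|[j|j]] /=; rewrite ?tmap_comp //; [left|right].
- have [J [e [t [te fe]]]] : exists (J : finType) (e : J -> V) t,
      (fun i => tmap e (t i)) = ts /\ forall j, exists i, tvars (ts i) (e j).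
    have /choice[F FP] (i : 'I_(rel_ar r)) :
        exists F : {J : finType & ((J -> V) * term L J)%type},
          tmap (tagged F).1 (tagged F).2 = ts i /\
          forall j, tvars (ts i) ((tagged F).1 j).
      by have [J [e [t' H]]] := term_support (ts i); exists (existT _ J (e, t')).
    pose J := {i : 'I_(rel_ar r) & tag (F i)}.
    exists J, (fun j : J => (tagged (F (tag j))).1 (tagged j)).
    exists (fun i => tmap (fun j => Tagged (fun i => tag (F i)) j : J)
                        (tagged (F i)).2).
    split=> [|[i j]] /=; last by exists i; have [_] := FP i; apply.
    by apply/funext => i; rewrite tmap_comp; have [<- _] := FP i.
  by exists J, e, (Rel t); split=> //=; rewrite te.
- by exists J, e, (Not psi).
- exists (J1 + J2)%type, (case_sum e1 e2), (And (fmap inl f') (fmap inr h')).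
  by split=> [|[j|j]] /=; rewrite ?fmap_comp //; [left|right].
- pose J' := {j : J | isSome (e j)}.
  have /choice[e' e'P] (j : J') : exists v, e (val j) = Some v.
    by case: j => j /=; case: (e j) => // v _; exists v.
  have ee' : omap e' \o insub = e.
    apply/funext => j /=; case: insubP => [j' _ <- /=|]; first by rewrite e'P.
    by case: (e j).
  exists J', e', (Ex (fmap insub psi)).
  split=> [|j] /=; first by rewrite fmap_comp ee'.
  by rewrite -e'P.
Qed.

(** Turns a finite part of a type into a formula on its parameters alone, which an elementary map
    preserves. *)
Lemma ex_closure n V (theta : fmla L ('I_n + V)) : exists theta' : fmla L V,
  (forall v, sat I v theta' <-> exists c, sat I (case_sum c v) theta) /\
  forall x, free theta' x -> free theta (inr x).
Proof.
elim: n theta => [|n IH] theta.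
  have f0 (i : 'I_0) : V by case: i.
  exists (fmap (case_sum f0 id) theta); split=> [v|x H]; last first.
    by have [[[]|y] //= fy ->] := free_fmap H.
  have E (c : 'I_0 -> U) : v \o case_sum f0 id = case_sum c v.
    by apply/funext => -[[]|].
  rewrite sat_fmap; split=> [th|[c]]; last by rewrite -E.
  by exists (v \o f0); rewrite -E.
pose s (z : 'I_n.+1 + V) : option ('I_n + V) :=
  match z with
  | inl i => if unlift ord0 i is Some j then Some (inl j) else None
  | inr x => Some (inr x)
  end.
have [theta' [th fth]] := IH (Ex (fmap s theta)); exists theta'; split.
  have E (c : 'I_n -> U) (x : U) (v : V -> U) :
      (fun o => if o is Some y then case_sum c v y else x) \o s =
      case_sum (fun i => if unlift ord0 i is Some j then c j else x) v.
    by apply/funext => -[i|//] /=; case: (unlift ord0 i).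
  move=> v; rewrite th /=; split=> [[c [x]]|[c cth]].
    by rewrite sat_fmap E; eexists; eassumption.
  exists (fun j => c (lift ord0 j)), (c ord0); rewrite sat_fmap E.
  suff -> : (fun i => if unlift ord0 i is Some j then c (lift ord0 j)
      else c ord0) = c by [].
  by apply/funext => i; case: unliftP => [j ->|->].
move=> x /fth /= H; have [[i|y] fy /=] := free_fmap H.
  by case: (unlift ord0 i).
by case=> ->.
Qed.

(** * Partial elementary relations *)

(* A partial elementary map, given by its graph: injectivity on both sides is
   automatic, and restriction, inversion and composition need no side
   conditions. *)
Definition el (R : U -> U -> Prop) : Prop :=
  forall n (s t : 'I_n -> U), (forall i, R (s i) (t i)) ->
    forall phi : fmla L 'I_n, sat I s phi <-> sat I t phi.

Definition diag (P : set U) (x y : U) : Prop := P x /\ x = y.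

Definition add (R : U -> U -> Prop) (a b x y : U) : Prop :=
  R x y \/ (x = a /\ y = b).

Definition ext (R : U -> U -> Prop) n (c d : 'I_n -> U) (x y : U) : Prop :=
  R x y \/ exists i, x = c i /\ y = d i.

(** Equality of tp(a, P) and tp(b, P); in this form it composes with other elementary relations. *)
Definition sim (P : set U) (a b : U) : Prop := el (add (diag P) a b).

Definition simt (P : set U) n (c d : 'I_n -> U) : Prop := el (ext (diag P) c d).

Lemma el_sat R V (s t : V -> U) (phi : fmla L V) : el R ->
  (forall x, free phi x -> R (s x) (t x)) -> sat I s phi <-> sat I t phi.
Proof.
move=> elR; have [J [e [psi [<- fe]]]] := fmla_support phi => Rst.
rewrite !sat_fmap.
have E (v : V -> U) : sat I (v \o e) psi <->
    sat I (v \o e \o enum_val) (fmap (@enum_rank J) psi).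
  rewrite sat_fmap; suff -> : (v \o e \o enum_val) \o enum_rank = v \o e by [].
  by apply/funext => j /=; rewrite enum_rankK.
by rewrite !E; apply: elR => i; apply: Rst.
Qed.

Lemma el_sub (R S : U -> U -> Prop) : el S -> (forall x y, R x y -> S x y) -> el R.
Proof. by move=> elS RS n s t Rst; apply: elS => i; apply: RS. Qed.

Lemma el_inv (R : U -> U -> Prop) : el R -> el (fun x y => R y x).
Proof. by move=> elR n s t Rst phi; rewrite (elR n t s). Qed.

Lemma el_comp (R S T : U -> U -> Prop) : el R -> el S ->
  (forall x z, T x z -> exists2 y, R x y & S y z) -> el T.
Proof.
move=> elR elS TRS n s t Tst phi.
have /choice[u uP] i : exists y, R (s i) y /\ S y (t i).
  by have [y] := TRS _ _ (Tst i); exists y.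
rewrite (elR _ s u) => [|i]; last by case: (uP i).
by apply: elS => i; case: (uP i).
Qed.

Lemma el_diag (P : set U) : el (diag P).
Proof.
move=> n s t st phi; suff -> : s = t by [].
by apply/funext => i; case: (st i).
Qed.

Lemma el_fun R x y y' : el R -> R x y -> R x y' -> y = y'.
Proof.
move=> elR xy xy'; pose s (i : 'I_2) := x.
pose t (i : 'I_2) := if i == ord0 then y else y'.
have Rst i : R (s i) (t i) by rewrite /s /t; case: ifP.
by have [+ _] := elR _ s t Rst (Eq (Var L ord0) (Var L ord_max)); apply.
Qed.

Lemma el_inj R x x' y : el R -> R x y -> R x' y -> x = x'.
Proof. by move=> /el_inv elR; apply: (el_fun elR). Qed.

Lemma el_fin (R : U -> U -> Prop) :
  (forall l : seq (U * U), (forall p, List.In p l -> R p.1 p.2) ->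
     el (fun x y => List.In (x, y) l)) -> el R.
Proof.
move=> H n s t Rst; apply: (H [seq (s i, t i) | i <- enum 'I_n]).
  by move=> p /List.in_map_iff[i [<- _]]; apply: Rst.
by move=> i; apply/List.in_map_iff; exists i; split=> //; apply/List_InP;
   rewrite mem_enum.
Qed.

Lemma sim_refl P a : sim P a a.
Proof. by apply: (el_sub (@el_diag setT)) => x y [[_ ->]|[-> ->]]. Qed.

Lemma sim_sym P a b : sim P a b -> sim P b a.
Proof.
move=> /el_inv ab; apply: el_sub ab _ => x y [[Px <-]|[-> ->]]; first by left.
by right.
Qed.

Lemma sim_trans P a b c : sim P a b -> sim P b c -> sim P a c.
Proof.
move=> ab bc; apply: el_comp ab bc _ => x z [[Px <-]|[-> ->]].
  by exists x; left.
by exists b; right.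
Qed.

Lemma sim_sub (P Q : set U) a b : sim Q a b -> P `<=` Q -> sim P a b.
Proof.
move=> ab PQ; apply: el_sub ab _ => x y [[/PQ Qx <-]|]; first by left.
by right.
Qed.

Lemma simtP (P : set U) a b :
  simt P (fun _ : 'I_1 => a) (fun=> b) <-> sim P a b.
Proof.
split=> ab; apply: el_sub ab _ => x y [Pxy|].
- by left.
- by move=> [-> ->]; right; exists ord0.
- by left.
- by move=> [_ [-> ->]]; right.
Qed.

Lemma simt_refl P n (c : 'I_n -> U) : simt P c c.
Proof. by apply: (el_sub (@el_diag setT)) => x y [[_ ->]|[i [-> ->]]]. Qed.

Lemma simt_sym P n (a b : 'I_n -> U) : simt P a b -> simt P b a.
Proof.
move=> /el_inv ab; apply: el_sub ab _ => x y [[Px <-]|[i [-> ->]]]; first by left.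
by right; exists i.
Qed.

Lemma simt_trans P n (a b c : 'I_n -> U) : simt P a b -> simt P b c -> simt P a c.
Proof.
move=> ab bc; apply: el_comp ab bc _ => x z [[Px <-]|[i [-> ->]]].
  by exists x; left.
by exists (b i); right; exists i.
Qed.

Lemma simt_sub (P Q : set U) n (a b : 'I_n -> U) :
  simt Q a b -> P `<=` Q -> simt P a b.
Proof.
move=> ab PQ; apply: el_sub ab _ => x y [[/PQ Qx <-]|]; first by left.
by right.
Qed.

Lemma sim_fin (P : set U) a b :
  (forall l : seq U, (forall x, List.In x l -> P x) ->
     sim [set x | List.In x l] a b) ->
  sim P a b.
Proof.
move=> H; apply: el_fin => l lP.
have [l' l'P ll'] : exists2 l', forall x, List.In x l' -> P x &
    forall x y, List.In (x, y) l -> (List.In x l' /\ x = y) \/ (x = a /\ y = b).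
  elim: l lP => [|[x y] l IH] lP; first by exists [::].
  have [|l' l'P ll'] := IH; first by move=> p lp; apply: lP; right.
  have /= [[Px <-]|[-> ->]] := lP (x, y) (or_introl erefl).
    exists (x :: l') => [z [<- //|/l'P //]|z z' [[<- <-]|/ll']].
      by left; split=> //; left.
    by case=> [[? ?]|]; [left; split=> //; right|right].
  by exists l' => // z z' [[<- <-]|/ll' //]; right.
by apply: el_sub (H l' l'P) _ => x y /ll'.
Qed.

Lemma simt_psat P n (c d : 'I_n -> U) (phi : pfmla L U n) : simt P c d ->
  params phi `<=` P -> psat I c phi <-> psat I d phi.
Proof.
move=> cd phiP; apply: (el_sat cd) => -[i|a] fz; first by right; exists i.
by left; split=> //; apply: phiP.
Qed.

Lemma realizes_tp P n (c d : 'I_n -> U) : realizes I d (tp I c P) -> simt P c d.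
Proof.
move=> dp m s t st phi.
have /choice[z zP] i : exists z : 'I_n + U,
    [/\ case_sum c id z = s i, case_sum d id z = t i & forall a, z = inr a -> P a].
  have [[Ps <-]|[k [-> ->]]] := st i; last by exists (inl k).
  by exists (inr (s i)); split=> // a [<-].
have -> : s = case_sum c id \o z by apply/funext => i /=; case: (zP i).
have -> : t = case_sum d id \o z by apply/funext => i /=; case: (zP i).
have zparams : params (fmap z phi) `<=` P.
  move=> a H; have [i _ e] := free_fmap H.
  by have [_ _] := zP i; apply.
rewrite -!sat_fmap; split=> [sphi|tphi]; first by apply: dp.
apply: contrapT => nsphi.
by apply: (dp (Not (fmap z phi))) => //; split.
Qed.

Lemma tpP P n (c d : 'I_n -> U) : tp I c P = tp I d P <-> simt P c d.
Proof.
split=> [e|cd]; first by apply: realizes_tp => phi; rewrite e => -[].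
by apply/seteqP; split=> phi [phiP /(simt_psat cd phiP) ?].
Qed.

End Syntax.

(** * Finite sets as lists *)

Definition ls (T : Type) (l : seq T) : set T := [set x | List.In x l].

Lemma ls_cat (T : Type) (l m : seq T) : ls (l ++ m) = ls l `|` ls m.
Proof.
by apply/seteqP; split=> x /=; rewrite /ls /= -List.in_app_iff.
Qed.

Lemma finite_ls (T : Type) (l : seq T) : finite_set (ls l).
Proof.
elim: l => [|x l IH]; first by rewrite (_ : ls _ = set0) //; apply/seteqP; split.
rewrite (_ : ls _ = [set x] `|` ls l) ?finite_setU //.
by apply/seteqP; split=> y /= [->|?]; [left|right|left|right].
Qed.

Lemma finite_set_ls (T : Type) (A : set T) : finite_set A -> exists l, A = ls l.
Proof.
move=> /(@finite_seqP {classic T})[l ->]; exists l.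
by apply/seteqP; split=> x /= /(@List_InP {classic T}).
Qed.

Lemma list_cover (T : Type) (P Q : T -> Prop) (l : seq T) :
  (forall x, List.In x l -> P x \/ Q x) ->
  exists2 l', ls l' `<=` P & forall x, List.In x l -> List.In x l' \/ Q x.
Proof.
elim: l => [|x l IH] lPQ; first by exists [::].
have [|l' l'P ll'] := IH; first by move=> y ly; apply: lPQ; right.
have [Px|Qx] := lPQ x (or_introl erefl).
  exists (x :: l') => [y [<- //|/l'P //]|y [<-|/ll'[]]].
  - by left; left.
  - by left; right.
  - by right.
by exists l' => // y [<-|/ll']; [right|].
Qed.

(** * Homogeneity of [C] and extension of elementary relations *)

Section Diagram.

Variables (L : language) (U : Type) (I : interp L U).
Variables (D : forall n, set (set (fmla L 'I_n))) (chi : Type) (C : set U).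
Hypothesis C_hom : homogeneous I D chi C chi C.
Hypothesis chi_inf : infinite_set [set: chi].

Local Notation el := (el I).
Local Notation sim := (sim I).
Local Notation simt := (simt I).

Lemma D_set_C : D_set I D C.
Proof. by have [[]] := C_hom. Qed.

Lemma el_D_set (R : U -> U -> Prop) (B : set U) : el R ->
  (forall y, B y -> exists2 x, C x & R x y) -> D_set I D B.
Proof.
move=> elR BR n c Bc.
have /choice[d dP] i : exists x, C x /\ R x (c i).
  by have [x] := BR _ (Bc i); exists x.
suff -> : tp0 I c = tp0 I d by apply: D_set_C => i; case: (dP i).
by apply/seteqP; split=> phi /=; rewrite /tp0 /=;
  apply (elR _ d c) => i; case: (dP i).
Qed.

Lemma S_D_tp (A : set U) n (c : 'I_n -> U) : A `<=` C -> (forall i, C (c i)) ->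
  S_D I D A (tp I c A).
Proof.
move=> AC Cc; split; [split|].
- by move=> a [phi [phiA _] /phiA].
- by move=> q _ qp; exists c => phi /qp[].
- move=> phi phiA; have [cphi|ncphi] := pselect (psat I c phi).
    by left.
  by right.
move=> d /realizes_tp cd; apply: el_D_set cd _ => y [Ay|[i _ <-]].
  by exists y; [apply: AC|left].
by exists (c i) => //; right; exists i.
Qed.

Lemma complete_realized (A : set U) n (p : set (pfmla L U n)) (c : 'I_n -> U) :
  complete_type I A p -> realizes I c p -> p = tp I c A.
Proof.
move=> [pA _ p_tot] cp; apply/seteqP; split=> phi.
  move=> pphi; split; last exact: cp.
  by move=> a phia; apply: pA; exists phi.
move=> [phiA cphi]; have [//|/cp] := p_tot _ phiA.
by move=> /(_ cphi).
Qed.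

Lemma S_D_realized (A : set U) n (p : set (pfmla L U n)) :
  A `<=` C -> A #< [set: chi] -> S_D I D A p ->
  exists2 c : 'I_n -> U, (forall i, C (c i)) & p = tp I c A.
Proof.
move=> AC Achi pS; have [c [Cc cp]] := C_hom.2 _ _ _ AC Achi pS.
by exists c => //; apply: complete_realized cp; case: pS.
Qed.

(* The type over the range of R that makes the extension elementary is complete
   and all its realizations give D-sets, so it is realized in C. *)
Lemma homogeneous_ext (N : set U) (lam : Type) (R : U -> U -> Prop) n
    (u : 'I_n -> U) :
  homogeneous I D chi C lam N ->
  el R -> (forall x y, R x y -> C x /\ N y) ->
  [set y | exists x, R x y] #< [set: lam] -> (forall i, C (u i)) ->
  exists2 u', (forall i, N (u' i)) & el (ext R u u').
Proof.
move=> N_hom elR RC Rchi Cu; set S := [set y | exists x, R x y] in Rchi *.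
have /choice[g gP] (y : U) : exists x, S y -> R x y.
  by have [[x Rxy]|] := pselect (S y); [exists x|exists y].
(* The image under [R] of the type of [u] over the domain of [R]: [g] evaluates a parameter in the
   range at its preimage. *)
pose p : set (pfmla L U n) :=
  [set phi | params phi `<=` S /\ sat I (case_sum u g) phi].
have real_el c : realizes I c p -> el (ext R u c).
  move=> cp m s t st phi.
  have /choice[z zP] i : exists z : 'I_n + U,
      [/\ case_sum u g z = s i, case_sum c id z = t i &
          forall a, z = inr a -> S a].
    have [Rst|[k [-> ->]]] := st i; last by exists (inl k).
    have St : S (t i) by exists (s i).
    exists (inr (t i)); split=> //=; last by move=> a [<-].
    exact: el_inj elR (gP _ St) Rst.
  have -> : s = case_sum u g \o z by apply/funext => i /=; case: (zP i).
  have -> : t = case_sum c id \o z by apply/funext => i /=; case: (zP i).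
  have zS : params (fmap z phi) `<=` S.
    by move=> a H; have [i _ e] := free_fmap H; have [_ _] := zP i; apply.
  rewrite -!sat_fmap; split=> [sphi|tphi]; first by apply: (cp (fmap z phi)).
  apply: contrapT => nsphi.
  by apply: (cp (Not (fmap z phi))) tphi; split.
(* A nonempty finite part of [p] follows from one formula of [p]; with its variables quantified it
   speaks of the range only, and [R] preserves it. *)
have conj_ex q : finite_set q -> q `<=` p -> q = set0 \/
    exists2 theta, p theta & forall c, psat I c theta -> realizes I c q.
  move=> /finite_set_ls[l ->] lp; elim: l lp => [|phi l IH] lp.
    by left; apply/seteqP; split.
  have [phiS uphi] := lp phi (or_introl erefl); right.
  have [|l0|[theta [thS uth] thl]] := IH; first by move=> x lx; apply: lp; right.
    exists phi => // c cphi psi [<- //|lpsi].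
    by have : ls l psi by []; rewrite l0.
  exists (And phi theta); first by split=> // a [/phiS|/thS].
  by move=> c [cphi cth] psi [<- //|]; apply: thl.
have p_cons : consistent I p.
  move=> q qfin qp; have [->|[theta [thS uth] thq]] := conj_ex q qfin qp.
    by exists u.
  have [theta' [thE thF]] := ex_closure I theta.
  have : sat I g theta' by apply/thE; exists u.
  rewrite (el_sat (t := id) elR) => [|a /thF/thS/gP //].
  by move=> /thE[c cth]; exists c; apply: thq.
have SN : S `<=` N by move=> y [x /RC[]].
have pS : S_D I D S p.
  split; first split=> //.
  - by move=> a [phi [phiS _] /phiS].
  - move=> phi phiS; have [|] := pselect (sat I (case_sum u g) phi).
      by left.
    by right.
  move=> c /real_el; move/el_D_set; apply=> y [Sy|[i _ <-]].
    by exists (g y); [have /RC[] := gP _ Sy|left; apply: gP].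
  by exists (u i) => //; right; exists i.
have [c [Nc cp]] := N_hom.2 _ _ _ SN Rchi pS.
by exists c => //; apply: real_el.
Qed.

Lemma homogeneous_add (N : set U) (lam : Type) (R : U -> U -> Prop) u :
  homogeneous I D chi C lam N ->
  el R -> (forall x y, R x y -> C x /\ N y) ->
  [set y | exists x, R x y] #< [set: lam] -> C u ->
  exists2 u', N u' & el (add R u u').
Proof.
move=> N_hom elR RC Rchi Cu.
have [//|u' Nu' elu] := @homogeneous_ext N lam R 1 (fun=> u) N_hom elR RC Rchi.
exists (u' ord0) => //; apply: el_sub elu _ => x y [Rxy|[-> ->]]; first by left.
by right; exists ord0.
Qed.

Definition finR (R : U -> U -> Prop) :=
  exists l : seq U, forall x y, R x y -> List.In x l /\ List.In y l.

Lemma finR_ran R : finR R -> [set y | exists x, R x y] #< [set: chi].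
Proof.
move=> [l lR]; apply: finite_card_lt => //.
by apply: sub_finite_set (finite_ls l) => y [x /lR[]].
Qed.

Lemma finR_inv R : finR R -> finR (fun x y => R y x).
Proof. by move=> [l lR]; exists l => x y /lR[]. Qed.

Lemma finR_add R a b : finR R -> finR (add R a b).
Proof.
move=> [l lR]; exists (a :: b :: l) => x y [/lR[]|[-> ->]] /=; tauto.
Qed.

(** * Perfect families of types *)

Lemma psat_inst n m (c : 'I_n -> U) (a : 'I_m -> U) (phi : fmla L 'I_(n + m)) :
  psat I c (inst a phi) <->
  sat I (fun i => match fintype.split i with inl j => c j | inr k => a k end) phi.
Proof.
rewrite /psat /inst sat_fmap; suff E : (fun z : 'I_n + U =>
    match z with inl i => c i | inr a => a end) \o
    (fun i => match fintype.split i with inl j => inl j | inr k => inr (a k) end) =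
    (fun i => match fintype.split i with inl j => c j | inr k => a k end).
  by rewrite E.
by apply/funext => i /=; case: (fintype.split i).
Qed.

Lemma params_inst n m (a : 'I_m -> U) (phi : fmla L 'I_(n + m)) :
  params (inst a phi) `<=` range a.
Proof.
move=> x H; have [i _] := free_fmap H.
by case: (fintype.split i) => // k [->]; exists k.
Qed.

(** The rank splits types by formulas [inst a psi], so a difference of types over [F] has to be
    brought to this form. *)
Lemma nsimt_inst F n (c d : 'I_n -> U) : ~ simt (ls F) c d ->
  exists m (a : 'I_m -> U) (psi : fmla L 'I_(n + m)),
    [/\ forall i, List.In (a i) F, psat I c (inst a psi) &
        ~ psat I d (inst a psi)].
Proof.
move=> /existsNP[k /existsNP[s /existsNP[t /not_implyP[st /existsNP[phi0 Nphi]]]]].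
have [phi [sphi tphi]] : exists phi : fmla L 'I_k, sat I s phi /\ ~ sat I t phi.
  have [sphi|nsphi] := pselect (sat I s phi0).
    by exists phi0; split=> // tphi; apply: Nphi.
  by exists (Not phi0); split=> //= ntphi; apply: Nphi; split=> //;
     move=> tphi; case: ntphi.
pose J : finType := {i : 'I_k | `[< List.In (s i) F /\ s i = t i >]}.
pose a (j : 'I_#|J|) := s (sval (enum_val j : J)).
have aF j : List.In (a j) F by rewrite /a; case: (enum_val j) => i /= /asboolP[].
pose v (c : 'I_n -> U) (i : 'I_(n + #|J|)) :=
  match fintype.split i with inl j => c j | inr k => a k end.
have /choice[z zP] i : exists z, v c z = s i /\ v d z = t i.
  have [[Fs sti]|[j [si ti]]] := st i; last first.
    by exists (lshift _ j); rewrite /v (unsplitK (inl j)).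
  have Ji : `[< List.In (s i) F /\ s i = t i >] by apply/asboolP.
  exists (rshift _ (enum_rank (exist _ i Ji : J))).
  by rewrite /v (unsplitK (inr _)) /a enum_rankK /= -sti.
exists #|J|, a, (fmap z phi); split=> //; rewrite psat_inst sat_fmap.
  suff -> : (fun i => match fintype.split i with inl j => c j | inr k => a k end)
      \o z = s by [].
  by apply/funext => i; case: (zP i).
suff -> : (fun i => match fintype.split i with inl j => d j | inr k => a k end)
    \o z = t by [].
by apply/funext => i; case: (zP i).
Qed.

Hypothesis D_tt : totally_transcendental I D C.

(* A family of types over finite sets that can always be split and extended
   consists of types of infinite rank. *)
Lemma no_perfect_family n (A : set U) (G : ('I_n -> U) -> seq U -> Prop) :
  A `<=` C ->
  (forall x F, G x F -> (forall i, C (x i)) /\ ls F `<=` A) ->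
  (forall x F, G x F -> exists x1 x2 F1,
     [/\ G x1 F1 /\ G x2 F1, ls F `<=` ls F1, simt (ls F) x x1,
         simt (ls F) x x2 & ~ simt (ls F1) x1 x2]) ->
  (forall x F F', G x F -> ls F' `<=` A -> exists x' F1,
     [/\ G x' F1, ls F `<=` ls F1, ls F' `<=` ls F1 & simt (ls F) x x']) ->
  forall x F, ~ G x F.
Proof.
move=> AC GC Gsplit Gext.
have tpS x y F F1 (r : set (pfmla L U n)) : r `<=` tp I x (ls F) ->
    ls F `<=` ls F1 -> simt (ls F) x y -> r `<=` tp I y (ls F1).
  move=> rx FF1 xy phi /rx[phiF xphi].
  split; last by apply/(simt_psat xy phiF).
  by move=> a /phiF/FF1.
(* The induction covers all members of the family and all parts [r] of their types, since the rank
   of a type is read off from its finitely parametrized parts. *)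
have rank_G alpha : forall x F r, G x F -> r `<=` tp I x (ls F) ->
    rank_fin_ge I D C A alpha r.
  elim: alpha => [|beta IH|K k0 f IH] x F r GxF rx /=; last 1 first.
  - by move=> k; apply: IH GxF rx.
  - have [Cx FA] := GC _ _ GxF.
    by exists x; split=> // phi /rx[].
  split.
    have [x1 [x2 [F1 [[G1 G2] FF1 xx1 xx2 nx12]]]] := Gsplit _ _ GxF.
    have [m [a [psi [aF1 x1psi x2psi]]]] := nsimt_inst nx12.
    have psiF1 : params (inst a psi) `<=` ls F1.
      by move=> _ /params_inst[i _ <-]; apply: aF1.
    exists m, a, psi; split.
    + by move=> i; have [_] := GC _ _ G1; apply; apply: aF1.
    + apply: IH G1 _ => phi [/(tpS _ _ _ _ _ rx FF1 xx1) //|->].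
      by split.
    + apply: IH G2 _ => phi [/(tpS _ _ _ _ _ rx FF1 xx2) //|->].
      by split.
  move=> m a Aa; pose F' := [seq a i | i <- enum 'I_m].
  have aF' i : List.In (a i) F'.
    by apply/List.in_map_iff; exists i; split=> //; apply/List_InP; rewrite mem_enum.
  have [|x' [F1 [G1 FF1 F'F1 xx']]] := Gext _ _ F' GxF.
    by move=> _ /List.in_map_iff[i [<- _]].
  have [Cx' _] := GC _ _ G1.
  (* Clause (b) of the rank: the joint type of [x'] and [a] is in [D], as both lie in [C]. *)
  exists (tp0 I (fun i =>
      match fintype.split i with inl j => x' j | inr k => a k end)).
    by apply: D_set_C => i; case: (fintype.split i) => // k; apply: AC.
  apply: IH G1 _ => phi [/(tpS _ _ _ _ _ rx FF1 xx') //|[psi xpsi <-]].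
  split; last by apply/psat_inst.
  by move=> _ /params_inst[i _ <-]; apply: F'F1.
move=> x F GxF; have [Cx FA] := GC _ _ GxF.
apply: (D_tt (p := tp I x (ls F)) AC).
- by move=> a [phi [phiF _] /phiF/FA].
- by move=> q _ qx; exists x => phi /qx[].
- by move=> alpha B q _ _ qx; apply: rank_G GxF _ => phi /qx[].
Qed.

Lemma no_perfect_family1 (A : set U) (G : U -> seq U -> Prop) :
  A `<=` C ->
  (forall x F, G x F -> C x /\ ls F `<=` A) ->
  (forall x F, G x F -> exists x1 x2 F1,
     [/\ G x1 F1 /\ G x2 F1, ls F `<=` ls F1, sim (ls F) x x1,
         sim (ls F) x x2 & ~ sim (ls F1) x1 x2]) ->
  (forall x F F', G x F -> ls F' `<=` A -> exists x' F1,
     [/\ G x' F1, ls F `<=` ls F1, ls F' `<=` ls F1 & sim (ls F) x x']) ->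
  forall x F, ~ G x F.
Proof.
move=> AC GC Gsplit Gext x F GxF.
apply: (@no_perfect_family 1 A (fun y => G (y ord0)) AC _ _ _ (fun=> x) F) => //.
- move=> {GxF x F} y F /GC[Cy FA]; split=> // i.
  by rewrite (ord1 i).
- move=> {GxF x F} y F /Gsplit[x1 [x2 [F1 [G12 FF1 y1 y2 n12]]]].
  have ey : y = fun=> y ord0 by apply/funext => i; rewrite (ord1 i).
  by exists (fun=> x1), (fun=> x2), F1; rewrite ey; split=> //; rewrite simtP.
- move=> {GxF x F} y F F' /Gext H /H[x' [F1 [G1 FF1 F'F1 yx']]].
  have ey : y = fun=> y ord0 by apply/funext => i; rewrite (ord1 i).
  by exists (fun=> x'), F1; rewrite ey; split=> //; rewrite simtP.
Qed.

(** For a tree with level [k] over [F k] the extension condition is automatic: a finite part of the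
    union of the [F k] lies in one of them, and iterated splitting reaches its level. *)
Lemma no_perfect_chain n (F : nat -> seq U) (X : nat -> ('I_n -> U) -> Prop) :
  (forall k, ls (F k) `<=` ls (F k.+1)) -> (forall k, ls (F k) `<=` C) ->
  (forall k x, X k x -> forall i, C (x i)) ->
  (forall k x, X k x -> exists x1 x2, [/\ X k.+1 x1 /\ X k.+1 x2,
     simt (ls (F k)) x x1, simt (ls (F k)) x x2 & ~ simt (ls (F k.+1)) x1 x2]) ->
  forall k x, ~ X k x.
Proof.
move=> FS FC XC Xsplit k x Xkx.
have Fmono j m : (j <= m)%N -> ls (F j) `<=` ls (F m).
  elim: m => [|m IH]; first by rewrite leqn0 => /eqP ->.
  by rewrite leq_eqVlt => /orP[/eqP -> //|/IH jm] y /jm/FS.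
pose A := [set y | exists k, ls (F k) y].
apply: (@no_perfect_family n A (fun y l => exists2 k, X k y & l = F k)
         _ _ _ _ x (F k)); last by exists k.
- by move=> y [j /FC].
- move=> y _ [j Xy ->]; split; first exact: XC Xy.
  by move=> z; exists j.
- move=> y _ [j /Xsplit[x1 [x2 [[X1 X2] y1 y2 n12]]] ->].
  by exists x1, x2, (F j.+1); split=> //; split; exists j.+1.
move=> y _ l [j Xy ->] lA.
have [m [jm lm]] : exists m, (j <= m)%N /\ ls l `<=` ls (F m).
  elim: l lA => [|z l IH] lA; first by exists j; split.
  have [|m [jm lm]] := IH; first by move=> w lw; apply: lA; right.
  have [i Fz] := lA z (or_introl erefl).
  exists (maxn i m); split; first by rewrite (leq_trans jm) ?leq_maxr.
  move=> w [<-|/lm Fw]; first by apply: Fmono Fz; rewrite leq_maxl.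
  by apply: Fmono Fw; rewrite leq_maxr.
have [y' [Xy' yy']] : exists y', X m y' /\ simt (ls (F j)) y y'.
  elim: m jm {lm} => [|m IH].
    by rewrite leqn0 => /eqP <-; exists y; split=> //; apply: simt_refl.
  rewrite leq_eqVlt => /orP[/eqP <-|jm].
    by exists y; split=> //; apply: simt_refl.
  have [y' [Xy' yy']] := IH jm.
  have [x1 [x2 [[X1 _] y1 _ _]]] := Xsplit _ _ Xy'.
  exists x1; split=> //; apply: simt_trans yy' _.
  by apply: simt_sub y1 _; apply: Fmono.
by exists y', (F m); split=> //; [exists m|apply: Fmono].
Qed.

(** Otherwise no [x] with the type of [c] over [B] is isolated over [B] and a finite part of [A],
    and the [v] that shows this splits the type of [x] without changing it over [B]. *)
Lemma isolated_dense (mu : Type) (A B : set U) c : infinite_set [set: mu] ->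
  A `<=` C -> B `<=` A -> B #< [set: mu] -> C c ->
  exists c' B', [/\ C c' /\ sim B c c', B `<=` B', B' `<=` A, B' #< [set: mu] &
    forall v, C v -> sim B' c' v -> sim A c' v].
Proof.
move=> mu_inf AC BA Bmu Cc; apply: contrapT => nex.
apply: (@no_perfect_family1 A
  (fun x F => [/\ C x, sim B c x & ls F `<=` A]) AC _ _ _ c [::]) => //.
- by move=> x F [].
- move=> x F [Cx cx FA].
  have [v [Cv xv nxv]] : exists v, [/\ C v, sim (B `|` ls F) x v & ~ sim A x v].
    apply: contrapT => nv; apply: nex; exists x, (B `|` ls F); split=> //.
    - by move=> y [/BA|/FA].
    - apply: card_lt_union => //; apply: finite_card_lt => //; exact: finite_ls.
    - by move=> v Cv xv; apply: contrapT => nxv; apply: nv; exists v.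
  have [l lA nl] : exists2 l, ls l `<=` A & ~ sim (ls l) x v.
    apply: contrapT => nl; apply: nxv; apply: sim_fin => l lA.
    by apply: contrapT => nxv; apply: nl; exists l.
  have FlA : ls (F ++ l) `<=` A by rewrite ls_cat => y [/FA|/lA].
  exists x, v, (F ++ l); split.
  + split; first by [].
    split=> //; apply: sim_trans cx _; apply: sim_sub xv _.
    by move=> y; left.
  + by rewrite ls_cat => y; left.
  + exact: sim_refl.
  + by apply: sim_sub xv _ => y; right.
  + by move=> xv'; apply: nl; apply: sim_sub xv' _; rewrite ls_cat => y; right.
- move=> x F F' [Cx cx FA] F'A; exists x, (F ++ F'); rewrite ls_cat; split.
  + by split=> // y [/FA|/F'A].
  + by move=> y; left.
  + by move=> y; right.
  + exact: sim_refl.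
- by split=> //; apply: sim_refl.
Qed.

End Diagram.

(** * Zipped lists and sublists *)

Lemma In_nth {T : Type} {x : T} {l} : List.In x l ->
  exists2 k, (k < size l)%N & forall d, nth d l k = x.
Proof.
elim: l => //= y l IH [->|/IH[k kl kx]]; first by exists 0.
by exists k.+1.
Qed.

Lemma In_map {T T' : Type} {f : T -> T'} {l y} : List.In y (map f l) ->
  exists2 x, List.In x l & y = f x.
Proof. by move=> /List.in_map_iff[x [<- lx]]; exists x. Qed.

Lemma zip_InP {T : Type} {l m : seq T} {x y} : List.In (x, y) (zip l m) ->
  List.In x l /\ List.In y m.
Proof.
elim: l m => [|u l IH] [|v m] //= [[-> ->]|/IH[]]; auto.
Qed.

Lemma zip_In_sym (T : Type) (l m : seq T) x y : List.In (x, y) (zip l m) ->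
  List.In (y, x) (zip m l).
Proof.
by elim: l m => [|u l IH] [|v m] //= [[-> ->]|/IH]; [left|right].
Qed.

Lemma zip_In_exists (T : Type) (l m : seq T) x : size l = size m -> List.In x l ->
  exists y, List.In (x, y) (zip l m).
Proof.
elim: l m => [|u l IH] [|v m] //= [lm] [->|/(IH _ lm)[y xy]].
  by exists v; left.
by exists y; right.
Qed.

Inductive sublist (T : Type) : seq T -> seq T -> Prop :=
| sublist_nil : sublist [::] [::]
| sublist_keep x l m : sublist l m -> sublist (x :: l) (x :: m)
| sublist_skip x l m : sublist l m -> sublist l (x :: m).

Lemma sublist_refl (T : Type) (l : seq T) : sublist l l.
Proof. by elim: l => [|x l IH]; constructor. Qed.

Lemma sublist_cat (T : Type) (l l' m m' : seq T) :
  sublist l l' -> sublist m m' -> sublist (l ++ m) (l' ++ m').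
Proof. by move=> ll' mm'; elim: ll' => //= *; constructor. Qed.

Lemma sublist_In (T : Type) (l m : seq T) : sublist l m -> ls l `<=` ls m.
Proof.
elim=> [|x l' m' _ IH|x l' m' _ IH] // y; last by right; apply: IH.
by move=> [->|/IH]; [left|right].
Qed.

Section Diagram.

Variables (L : language) (U : Type) (I : interp L U).
Variables (D : forall n, set (set (fmla L 'I_n))) (chi : Type) (C : set U).
Hypothesis C_hom : homogeneous I D chi C chi C.
Hypothesis chi_inf : infinite_set [set: chi].
Hypothesis D_tt : totally_transcendental I D C.

Local Notation el := (el I).
Local Notation sim := (sim I).
Local Notation simt := (simt I).

(** * Counting types *)

Section Counting.

Variables (Lam : Type) (c0 : U) (X : set U).
Hypothesis Lam_inf : infinite_set [set: Lam].
Hypothesis D_le : total_set D #<= [set: Lam].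
Hypothesis X_sub : X `<=` C.
Hypothesis X_le : X #<= [set: Lam].

(** At most |Lam| types over [X] are realized in [P]. *)
Let small (P : set U) : Prop :=
  exists e : Lam -> U, forall c, P c -> exists l, C (e l) /\ sim X (e l) c.

Let small_sub (P Q : set U) : small Q -> P `<=` Q -> small P.
Proof. by move=> [e eQ] PQ; exists e => c /PQ/eQ. Qed.

Let small_bigcup (Y : Type) (P : Y -> set U) : [set: Y] #<= [set: Lam] ->
  (forall y, small (P y)) -> small [set c | exists y, P y c].
Proof.
move=> Yle /choice[e eP].
have [[y0 _]|Y0] := pselect ([set: Y] !=set0); last first.
  by exists (fun=> c0) => c [y _]; case: Y0; exists y.
have [l0 _] := infinite_setN0 Lam_inf.
have [g gs] := card_le_surjP (y0, l0)
  (card_prodT Lam_inf Yle (card_lexx [set: Lam])).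
exists (fun l => e (g l).1 (g l).2) => c [y /eP[l el_c]].
by have [k gk] := gs (y, l) Logic.I; exists k; rewrite gk.
Qed.

Let small_union (P Q : set U) : small P -> small Q -> small (P `|` Q).
Proof.
move=> sP sQ.
have H := @small_bigcup bool (fun b : bool => if b then P else Q).
apply: small_sub (H _ _) _ => [|[]//|c [Pc|Qc]]; [|by exists true|by exists false].
by have [] := @finite_card_lt _ _ [set: bool] Lam_inf finite_finset.
Qed.

(** The analogue of a neighbourhood with uncountable trace in the Cantor-Bendixson argument. *)
Let big (F : seq U) (x : U) : Prop := ~ small [set c | C c /\ sim (ls F) x c].

Let code (F : seq U) (c : U) : {n : nat & set (fmla L 'I_n)} :=
  existT _ (size F).+1 (tp0 I (fun i : 'I_(size F).+1 => nth c (c :: F) i)).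

Let code_sim F c d : code F c = code F d -> sim (ls F) c d.
Proof.
move=> cd m s t st phi.
have e := Eqdep_dec.inj_pair2_eq_dec _ PeanoNat.Nat.eq_dec _ _ _ _ cd.
have /choice[z zP] i : exists z : 'I_(size F).+1,
    nth c (c :: F) z = s i /\ nth d (d :: F) z = t i.
  have [[Fs <-]|[-> ->]] := st i; last by exists ord0.
  have [k kF kx] := In_nth Fs.
  by exists (@Ordinal (size F).+1 k.+1 kF) => /=.
have -> : s = (fun i : 'I_(size F).+1 => nth c (c :: F) i) \o z.
  by apply/funext => i /=; case: (zP i).
have -> : t = (fun i : 'I_(size F).+1 => nth d (d :: F) i) \o z.
  by apply/funext => i /=; case: (zP i).
rewrite -(sat_fmap I z (fun i => nth c (c :: F) i)).
rewrite -(sat_fmap I z (fun i => nth d (d :: F) i)).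
by have : tp0 I (fun i : 'I_(size F).+1 => nth c (c :: F) i) (fmap z phi) <->
  tp0 I (fun i : 'I_(size F).+1 => nth d (d :: F) i) (fmap z phi) by rewrite e.
Qed.

(** There are at most |Lam| finite parts of [X] and, by [D_le], at most |Lam| types over each; every
    one of these types that is not big contributes a small set. *)
Let small_exceptions :
  small [set c | C c /\ exists2 F, ls F `<=` X & ~ big F c].
Proof.
have [l0 _] := infinite_setN0 Lam_inf.
have [h hs] := card_le_surjP c0 X_le.
have hseq F : ls F `<=` X -> exists s, F = map h s.
  elim: F => [|x F IH] FX; first by exists [::].
  have [|s ->] := IH; first by move=> y Fy; apply: FX; right.
  by have [k <-] := hs x (FX x (or_introl erefl)); exists (k :: s).
have [j j_inj] := (card_le_injP _ l0).1 D_le.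
have Yle : [set: seq Lam * Lam] #<= [set: Lam].
  exact: card_prodT Lam_inf (card_seqT Lam_inf) (card_lexx _).
have codeD F c : C c -> ls F `<=` C -> total_set D (code F c).
  move=> Cc FC; apply: (D_set_C C_hom) => i.
  case: i => -[|k] //= kF; apply: FC.
  by elim: F k kF => [|x F IH] [|k] //= kF; [left|right; apply: IH].
apply: small_sub (small_bigcup (P := fun y => [set c |
  [/\ C c, ls (map h y.1) `<=` X, ~ big (map h y.1) c &
      j (code (map h y.1) c) = y.2]]) Yle _) _; last first.
  move=> c [Cc [F FX nbig]]; have [s Fs] := hseq F FX.
  by exists (s, j (code F c)) => /=; rewrite -Fs.
move=> [s l] /=; set F := map h s.
have [[c [Cc FX /contrapT[e eP] jc]]|none] := pselect (exists c,
  [/\ C c, ls F `<=` X, ~ big F c & j (code F c) = l]).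
  exists e => d [Cd _ _ jd]; apply: eP; split=> //; apply: code_sim.
  have FC : ls F `<=` C by move=> y /FX/X_sub.
  by apply: j_inj; [exact: codeD|exact: codeD|rewrite jc jd].
by exists (fun=> c0) => c Hc; case: none; exists c.
Qed.

(** Big types form a perfect family. If the extensions of a big type all of whose restrictions to
    finite sets are big had one type over [X], they would form, with the exceptions, a small set. *)
Lemma types_enumerable : exists e : Lam -> U, forall c, C c ->
  exists l, C (e l) /\ sim X (e l) c.
Proof.
have noG := @no_perfect_family1 _ _ _ _ _ _ C_hom D_tt X
  (fun x F => [/\ C x, ls F `<=` X & big F x]) X_sub.
have none x F : ~ [/\ C x, ls F `<=` X & big F x].
  apply: noG => {x F}.
  - by move=> x F [].
  - move=> x F [Cx FX bigx]; apply: contrapT => nsplit; apply: bigx.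
    pose good := [set c | [/\ C c, sim (ls F) x c &
      forall F1, ls F1 `<=` X -> big F1 c]].
    have good_sim c d : good c -> good d -> sim X c d.
      move=> [Cc xc bigc] [Cd xd bigd]; apply: sim_fin => l lX.
      have FlX : ls (F ++ l) `<=` X by rewrite ls_cat => y [/FX|/lX].
      apply: contrapT => ncd; apply: nsplit; exists c, d, (F ++ l); split=> //.
      + by split; split=> //; [apply: bigc|apply: bigd].
      + by rewrite ls_cat => y; left.
      + by move=> cd; apply: ncd; apply: sim_sub cd _; rewrite ls_cat => y; right.
    have small_good : small good.
      have [[c gc]|ng] := pselect (exists c, good c); last first.
        by exists (fun=> c0) => c gc; case: ng; exists c.
      exists (fun=> c) => d gd; have [l0 _] := infinite_setN0 Lam_inf.
      by exists l0; split; [case: gc|exact: good_sim].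
    apply: small_sub (small_union small_good small_exceptions) _ => c [Cc xc].
    have [gc|ngc] := pselect (good c); [by left|right; split=> //].
    apply: contrapT => nF; apply: ngc; split=> // F1 F1X nbig.
    by apply: nF; exists F1.
  - move=> x F F' [Cx FX bigx] F'X.
    have FF'X : ls (F ++ F') `<=` X by rewrite ls_cat => y [/FX|/F'X].
    apply: contrapT => nex; apply: bigx.
    apply: small_sub small_exceptions _ => c [Cc xc]; split=> //.
    exists (F ++ F') => // bigc; apply: nex; exists c, (F ++ F'); split=> //.
    + by rewrite ls_cat => y; left.
    + by rewrite ls_cat => y; right.
have [e eP] : small C.
  apply: small_sub small_exceptions _ => c Cc; split=> //.
  by exists [::] => // bigc; case: (none c [::]); split.
by exists e.
Qed.

End Counting.

(** * Non-splitting *)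

Section Model.

Variable M : set U.
Hypothesis MC : M `<=` C.
Hypothesis M_omega : forall l c, ls l `<=` M -> C c ->
  exists2 u, M u & sim (ls l) c u.

Lemma C_add (R : U -> U -> Prop) x : finR R ->
  (forall u v, R u v -> C u /\ C v) -> el R -> C x ->
  exists2 u, C u & el (add R x u).
Proof.
move=> finR0 RC elR Cx.
exact: (homogeneous_add C_hom C_hom elR RC (finR_ran chi_inf finR0)).
Qed.

(** The value is first found in [C], then moved into [M] over the finitely many old values. *)
Lemma omega_add (R : U -> U -> Prop) x : finR R ->
  (forall u v, R u v -> C u /\ M v) -> el R -> C x ->
  exists2 u, M u & el (add R x u).
Proof.
move=> finR0 RM elR Cx.
have [|v Cv elv] := C_add finR0 _ elR Cx.
  by move=> u v /RM[Cu /MC].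
have [l lR] := finR0.
have [l' l'M ll'] : exists2 l', ls l' `<=` M &
    forall y, List.In y l -> List.In y l' \/ ~ M y.
  by apply: list_cover => y _; apply: EM.
have [u Mu vu] := M_omega l'M Cv; exists u => //.
apply: el_comp elv vu _ => y z [Ryz|[-> ->]].
  have [_ Mz] := RM _ _ Ryz; have [_ /ll'[lz|//]] := lR _ _ Ryz.
  by exists z; [left|left].
by exists v; right.
Qed.

Lemma omega_adds (R : U -> U -> Prop) xs : finR R ->
  (forall u v, R u v -> C u /\ M v) -> el R -> ls xs `<=` C ->
  exists S : U -> U -> Prop, [/\ finR S, el S, forall u v, R u v -> S u v,
    forall x, List.In x xs -> exists u, S x u &
    forall u v, S u v -> M v /\ (R u v \/ List.In u xs)].
Proof.
move=> finR0 RM elR; elim: xs => [|x xs IH] xsC.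
  by exists R; split=> // u v Ruv; split; [case: (RM _ _ Ruv)|left].
have [|S [finS elS RS Sxs SM]] := IH; first by move=> y ?; apply: xsC; right.
have [||u Mu elu] := @omega_add S x finS _ elS.
- move=> y z /[dup] Syz /SM[Mz [/RM[//]|xsy]]; split=> //.
  by apply: xsC; right.
- by apply: xsC; left.
exists (add S x u); split=> //.
- exact: finR_add.
- by move=> y z /RS; left.
- by move=> y [<-|/Sxs[v Syv]]; [exists u; right|exists v; left].
- move=> y z [/SM[Mz [Ryz|xsy]]|[-> ->]]; split=> //; first by left.
    by right; right.
  by right; left.
Qed.

(** tp(c, M) does not split over [b]: tuples of [M] with the same type over [b] keep it when [c] is
    added. *)
Definition nonsplitting (b : seq U) (c : U) : Prop :=
  forall R : U -> U -> Prop, (forall x y, R x y -> M x /\ M y) ->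
    (forall x, List.In x b -> R x x) -> el R -> el (add R c c).

Lemma exists_nonsplitting c : C c -> exists2 b, ls b `<=` M & nonsplitting b c.
Proof.
move=> Cc; apply: contrapT => nb.
have nsplit b : ls b `<=` M -> ~ nonsplitting b c.
  by move=> bM bc; apply: nb; exists b.
have dom_list (R : U -> U -> Prop) : finR R ->
    exists l, forall x, List.In x l <-> exists y, R x y.
  move=> [l lR].
  have [l' l'R ll'] : exists2 l', ls l' `<=` [set x | exists y, R x y] &
      forall x, List.In x l -> List.In x l' \/ ~ exists y, R x y.
    by apply: list_cover => x _; apply: EM.
  exists l' => x; split=> [/l'R//|[y Rxy]].
  have [/ll'[//|nx] _] := lR _ _ Rxy.
  by case: nx; exists y.
(* Members of the family are conjugates of [c] over [F] under finite elementary maps of [M]. *)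
pose G x F := C x /\ exists R : U -> U -> Prop,
  [/\ finR R, forall u v, R u v -> M u /\ M v,
      forall y, List.In y F -> exists z, R y z & el (add R x c)].
apply: (@no_perfect_family1 _ _ _ _ _ _ C_hom D_tt M G MC _ _ _ c [::]).
- move=> x F [Cx [R [_ RM RF _]]]; split=> // y /RF[z /RM[]].
  by [].
- move=> x F [Cx [R [finR0 RM RF elx]]].
  have elR : el R by apply: el_sub elx _ => u v; left.
  have [b bP] := dom_list _ (finR_inv finR0).
  have bM : ls b `<=` M by move=> y /bP[z /RM[]].
  have /existsNP[R0 /not_implyP[R0M /not_implyP[R0b /not_implyP[elR0 nR0]]]] :=
    nsplit b bM.
  (* A finite part of the splitting map suffices; it is kept the identity on [b], the range of
     [R]. *)
  have [R1 [finR1 R1R0 R1b nR1]] : exists R1 : U -> U -> Prop,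
      [/\ finR R1, forall u v, R1 u v -> R0 u v,
          forall u, List.In u b -> R1 u u & ~ el (add R1 c c)].
    have [l lR0 nl] : exists2 l, (forall p, List.In p l -> add R0 c c p.1 p.2) &
        ~ el (fun x y => List.In (x, y) l).
      apply: contrapT => nl; apply: nR0; apply: el_fin => l lR0.
      by apply: contrapT => nl'; apply: nl; exists l.
    have [l' l'R0 ll'] : exists2 l', ls l' `<=` [set p | R0 p.1 p.2] &
        forall p, List.In p l -> List.In p l' \/ (p.1 = c /\ p.2 = c).
      by apply: list_cover => p /lR0.
    exists (fun u v => List.In (u, v) l' \/ diag (ls b) u v); split.
    - exists (map fst l' ++ map snd l' ++ b) => u v; rewrite !List.in_app_iff.
      move=> [uv|[bu <-]]; last by auto.
      split; [left|right; left]; apply/List.in_map_iff; exists (u, v) => //.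
    - by move=> u v [/l'R0//|[bu <-]]; apply: R0b.
    - by move=> u bu; right.
    - move=> elR1; apply: nl; apply: el_sub elR1 _ => u v /ll'[luv|[/= -> ->]].
        by left; left.
      by right.
  have elR1 : el R1 by apply: el_sub elR0 R1R0.
  have [xs xsP] := dom_list _ finR1.
  (* [S] prolongs the inverse of [R] and maps the domain of [R1] to a set [F1], which [W] matches
     with the range of [R1]. The two matchings give conjugates [x1] and [x2] of [c] over [F1]; both
     continue [x], as [R1] fixes [b]. *)
  have [|||S [finS elS RS Sxs SM]] :=
    @omega_adds (fun u v => R v u) xs (finR_inv finR0).
  - by move=> u v /RM[Mv Mu]; split=> //; apply: MC.
  - exact: el_inv.
  - by move=> y /xsP[z /R1R0/R0M[My _]]; apply: MC.
  have SR1 u v : S u v -> exists w, R1 u w.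
    move=> /SM[_ [Rvu|/xsP//]]; exists u; apply: R1b.
    by apply/bP; exists v.
  have SMM u v : S u v -> M u /\ M v.
    by move=> /[dup] /SM[Mv _] /SR1[w /R1R0/R0M[Mu _]].
  pose W u w := exists2 v, S v u & R1 v w.
  have elW : el W.
    by apply: el_comp (el_inv elS) elR1 _ => u w [v Svu R1vw]; exists v.
  have finW : finR W.
    have [[l1 l1S] [l2 l2R1]] := (finS, finR1).
    exists (l1 ++ l2) => u w [v /l1S[_ l1u] /l2R1[_ l2w]].
    by rewrite !List.in_app_iff; auto.
  have WM u w : W u w -> M u /\ M w.
    by move=> [v /SMM[_ Mu] /R1R0/R0M[_ Mw]].
  have [|x1 Cx1 elx1] := C_add finS _ elS Cc.
    by move=> u v /SMM[/MC Cu /MC Cv].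
  have [|x2 Cx2 elx2] := C_add (finR_inv finW) _ (el_inv elW) Cc.
    by move=> u v /WM[/MC Cu /MC Cv].
  have [F1 F1P] := dom_list _ (finR_inv finS).
  have FF1 : ls F `<=` ls F1.
    by move=> y /RF[z Ryz]; apply/F1P; exists z; apply: RS.
  exists x1, x2, F1; split=> //.
  + split; split=> //.
      exists (fun u v => S v u); split.
      * exact: finR_inv.
      * by move=> u v /SMM[].
      * by move=> y /F1P.
      * by apply: el_sub (el_inv elx1) _ => u v [|[-> ->]]; [left|right].
    exists W; split=> //.
      by move=> y /F1P[z Szy]; have [w] := SR1 _ _ Szy; exists w, z.
    by apply: el_sub (el_inv elx2) _ => u v [|[-> ->]]; [left|right].
  + apply: el_comp elx elx1 _ => u v [[/RF[z Ruz] <-]|[-> ->]].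
      by exists z; [left|left; apply: RS].
    by exists c; right.
  + apply: el_comp elx elx2 _ => u v [[/RF[z Ruz] <-]|[-> ->]].
      exists z; left => //; exists z; first exact: RS.
      by apply: R1b; apply/bP; exists u.
    by exists c; right.
  (* If [x1] and [x2] agreed over [F1], composing the two matchings would make [R1] with the pair
     (c, c) elementary. *)
  + move=> x12; apply: nR1.
    have elT : el (add (fun u v => S u v) c x2).
      apply: el_comp elx1 x12 _ => u v [Suv|[-> ->]]; last first.
        by exists x1; right.
      by exists v; [left|left; split=> //; apply/F1P; exists u].
    apply: el_comp elT (el_inv elx2) _ => u v [R1uv|[-> ->]]; last first.
      by exists x2; right.
    have [|z Suz] := Sxs u; first by apply/xsP; exists v.
    by exists z; left => //; exists u.
- move=> x F F' [Cx [R [finR0 RM RF elx]]] F'M.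
  have elR : el R by apply: el_sub elx _ => u v; left.
  have [||S [finS elS RS SF' SM]] := @omega_adds R F' finR0 _ elR.
  - by move=> u v /RM[Mu Mv]; split=> //; apply: MC.
  - by move=> y /F'M/MC.
  have SMM u v : S u v -> M u /\ M v.
    by move=> /[dup] /SM[Mv [/RM[]|/F'M]].
  have [|x' Cx' elx'] := C_add (finR_inv finS) _ (el_inv elS) Cc.
    by move=> u v /SMM[/MC Cu /MC Cv].
  exists x', (F ++ F'); split.
  + split=> //; exists S; split=> //.
      move=> y /List.in_app_iff[/RF[z Ryz]|/SF'//].
      by exists z; apply: RS.
    by apply: el_sub (el_inv elx') _ => u v [|[-> ->]]; [left|right].
  + by rewrite ls_cat => y; left.
  + by rewrite ls_cat => y; right.
  + apply: el_comp elx elx' _ => u v [[/RF[z Ruz] <-]|[-> ->]].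
      by exists z; left => //; apply: RS.
    by exists c; right.
- split=> //; exists (fun _ _ => False); split=> //; first by exists [::].
  by apply: (el_sub (@sim_refl _ _ I set0 c)) => u v [|[-> ->]] //; right.
Qed.

End Model.

End Diagram.

(** * Morley sequences *)

Section Morley.

Variables (L : language) (U : Type) (I : interp L U).
Variables (D : forall n, set (set (fmla L 'I_n))) (chi : Type) (C : set U).
Hypothesis C_hom : homogeneous I D chi C chi C.
Hypothesis chi_inf : infinite_set [set: chi].
Hypothesis D_tt : totally_transcendental I D C.

Local Notation el := (el I).
Local Notation sim := (sim I).
Local Notation simt := (simt I).

Variable M : set U.
Hypothesis MC : M `<=` C.
Hypothesis M_omega : forall l c, ls l `<=` M -> C c ->
  exists2 u, M u & sim (ls l) c u.

Variables (b : seq U) (c : U).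
Hypothesis Cc : C c.
Hypothesis bM : ls b `<=` M.
Hypothesis c_ns : nonsplitting I M b c.

(* The newest element comes first. *)
Fixpoint morley (B l : seq U) : Prop :=
  if l is x :: l' then [/\ M x, sim (ls (B ++ l')) c x & morley B l'] else True.

Definition zipr (B l m : seq U) (x y : U) : Prop :=
  diag (ls B) x y \/ List.In (x, y) (zip l m).

Lemma morley_sub B l : morley B l -> ls l `<=` M.
Proof. by elim: l => [_|x l IH /= [Mx _ /IH lM]] y // [<-|/lM]. Qed.

Lemma zipr_inv B l m : el (zipr B l m) -> el (zipr B m l).
Proof.
move=> /el_inv elz; apply: el_sub elz _ => x y [[Bx <-]|xy]; first by left.
by right; apply: zip_In_sym.
Qed.

Section Base.

Variable B : seq U.
Hypothesis bB : ls b `<=` ls B.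
Hypothesis BM : ls B `<=` M.

Lemma zipr_add l m : ls l `<=` M -> ls m `<=` M -> el (zipr B l m) ->
  el (add (zipr B l m) c c).
Proof.
move=> lM mM; apply: c_ns => [x y [[/BM Mx <-]|/zip_InP[/lM ? /mM ?]] //|x /bB Bx].
by left.
Qed.

(** By induction: [x] goes to [c] over [l], then [l] moves to [m] under [c] by non-splitting, and
    [c] goes to [y] over [m]. *)
Lemma morley_el l m : morley B l -> morley B m -> size l = size m ->
  el (zipr B l m).
Proof.
elim: l m => [|x l IH] [|y m] //= => [_ _ _|].
  by apply: el_sub (@el_diag _ _ I (ls B)) _ => u v [|].
move=> [Mx cx lB] [My cy mB] [lm].
have elc := zipr_add (morley_sub lB) (morley_sub mB) (IH _ lB mB lm).
have elx : el (add (zipr B l m) x c).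
  apply: el_comp (sim_sym cx) elc _ => u v [uv|[-> ->]].
    exists u; last by left.
    left; split=> //; rewrite ls_cat.
    by case: uv => [[Bu _]|/zip_InP[lu _]]; [left|right].
  by exists c; right.
apply: el_comp elx cy _ => u v [uv|[[<- <-]|uv]]; last 2 first.
- by exists c; right.
- exists v; first by left; right.
  by left; split=> //; rewrite ls_cat; right; case: (zip_InP uv).
- exists v; first by left; left.
  by left; split=> //; rewrite ls_cat; left; case: uv => Bu <-.
Qed.

Lemma morley_inv l m : morley B m -> ls l `<=` M -> size l = size m ->
  el (zipr B l m) -> morley B l.
Proof.
elim: l m => [|x l IH] [|y m] //= [My cy mB] lM [lm] elxy.
have lM' : ls l `<=` M by move=> u lu; apply: lM; right.
have ellm : el (zipr B l m).
  by apply: el_sub elxy _ => u v [uv|uv]; [left|right; right].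
split; [by apply: lM; left| |exact: IH mB lM' lm ellm].
have elc := zipr_add lM' (morley_sub mB) ellm.
have elcy : el (add (zipr B l m) c y).
  apply: el_comp elc cy _ => u v [uv|[-> ->]]; last by exists c; right.
  exists v; first by left.
  left; split=> //; rewrite ls_cat.
  by case: uv => [[Bu <-]|/zip_InP[_ mv]]; [left|right].
apply: el_comp elcy (el_inv elxy) _ => u v [[+ <-]|[-> ->]]; last first.
  by exists y; right => //; left.
rewrite ls_cat => -[Bu|lu]; first by exists u; left => //; left.
have [w uw] := zip_In_exists lm lu.
by exists w; [left; right|right; right].
Qed.

Lemma morley_sublist l m : sublist l m -> morley B m -> morley B l.
Proof.
elim=> [|x l' m' lm IH|x l' m' lm IH] //= [Mx cx /IH lB] //; split=> //.
apply: sim_sub cx _; rewrite !ls_cat => y [By|ly]; [by left|right].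
exact: sublist_In lm _ ly.
Qed.

Lemma exists_morley n : exists2 m, morley B m & size m = n.
Proof.
elim: n => [|n [m mB mn]]; first by exists [::].
have [|x Mx cx] := @M_omega (B ++ m) c _ Cc.
  by rewrite ls_cat => y [/BM|/(morley_sub mB)].
by exists (x :: m) => //=; rewrite mn.
Qed.

(** A longer Morley sequence with one entry removed has the type of [l1 ++ l2], by [morley_el]; the
    removed entry is carried along by omega-homogeneity. *)
Lemma morley_insert l1 l2 : morley B (l1 ++ l2) ->
  exists x, morley B (l1 ++ x :: l2).
Proof.
move=> lB; have [m mB sm] := exists_morley (size l1 + (size l2).+1).
have em : take (size l1) m ++ drop (size l1) m = m by apply: cat_take_drop.
have s1 : size (take (size l1) m) = size l1.
  by rewrite size_take sm; case: ltnP => //; rewrite leqNgt -addSnnS ltn_addr.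
have s2 : size (drop (size l1) m) = (size l2).+1 by rewrite size_drop sm addKn.
move: em s1 s2; set m1 := take _ m; case: (drop _ m) => [//|y m2] em s1 [s2].
rewrite -em in mB.
have mB' : morley B (m1 ++ m2).
  apply: morley_sublist mB; apply: sublist_cat (sublist_refl _) _.
  by apply: sublist_skip; apply: sublist_refl.
have elm : el (zipr B (m1 ++ m2) (l1 ++ l2)).
  by apply: morley_el => //; rewrite !size_cat s1 s2.
have My : M y by apply: (morley_sub mB); apply/List.in_app_iff; right; left.
have fin : finR (zipr B (m1 ++ m2) (l1 ++ l2)).
  exists (B ++ (m1 ++ m2) ++ (l1 ++ l2)) => u v.
  by case=> [[Bu <-]|/zip_InP[mu lu]]; split; apply/List.in_app_iff;
    [left|left|right; apply/List.in_app_iff; left|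
     right; apply/List.in_app_iff; right].
have [|x Mx elx] := omega_add C_hom chi_inf MC M_omega fin _ elm (MC My).
  move=> u v [[Bu <-]|/zip_InP[mu lv]]; first by split; [apply: MC|]; apply: BM.
  by split; [apply: MC; apply: (morley_sub mB')|apply: (morley_sub lB)].
exists x; apply: (@morley_inv _ (m1 ++ y :: m2)) => //.
- move=> u /List.in_app_iff[lu|[<- //|lu]]; apply: (morley_sub lB);
    by apply/List.in_app_iff; auto.
- by rewrite !size_cat /= s1 s2.
apply: zipr_inv; apply: el_sub elx _ => u v.
rewrite /zipr zip_cat // => -[Buv|]; first by left; left.
move=> /List.in_app_iff[uv|[[<- <-]|uv]].
- by left; right; rewrite zip_cat //; apply/List.in_app_iff; left.
- by right.
- by left; right; rewrite zip_cat //; apply/List.in_app_iff; right.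
Qed.

(** One step towards a dense order: every cut of [l2], the ends included, receives a new entry
    [w]. *)
Lemma morley_dense l1 l2 : morley B (l1 ++ l2) -> exists2 l',
  morley B (l1 ++ l') & forall m1 m2, l2 = m1 ++ m2 ->
    exists k1 w k2, [/\ l' = k1 ++ w :: k2, sublist m1 k1 & sublist m2 k2].
Proof.
elim: l2 l1 => [|x l IH] l1 lB.
  have [y yB] := morley_insert lB; exists [:: y] => // -[|//] [|//] _.
  by exists [::], y, [::]; split=> //; apply: sublist_nil.
have [|l' lB' l'd] := IH (l1 ++ [:: x]); first by rewrite -catA.
have [|y yB] := @morley_insert l1 (x :: l'); first by rewrite -catA in lB'.
exists (y :: x :: l') => // -[|x' m1] m2 /=.
  move=> <-; exists [::], y, (x :: l'); split=> //; first exact: sublist_nil.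
  have [k1 [w [k2 [-> _ lk2]]]] := l'd [::] l erefl.
  apply: sublist_keep; rewrite -[l]/([::] ++ l).
  apply: sublist_cat; last by apply: sublist_skip.
  by elim: (k1) => [|z k IHk]; constructor.
case=> <- /l'd[k1 [w [k2 [-> s1 s2]]]].
exists (y :: x :: k1), w, k2; split=> //.
by apply: sublist_skip; apply: sublist_keep.
Qed.

(* If two independent realizations were not exchangeable, the order type of a
   Morley sequence could be made dense, and its cuts would form a perfect tree
   of types. *)
Lemma morley_swap x y : morley B [:: y; x] -> el (zipr B [:: y; x] [:: x; y]).
Proof.
move=> xyB; apply: contrapT => nswap.
have step (l : {l | morley B l}) : exists l' : {l | morley B l},
    forall m1 m2, sval l = m1 ++ m2 -> exists k1 w k2,
      [/\ sval l' = k1 ++ w :: k2, sublist m1 k1 & sublist m2 k2].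
  case: l => l lB /=; have [l' lB' l'd] := @morley_dense [::] l lB.
  by exists (exist _ l' lB').
have [next nextP] := choice step.
pose S n := iter n next (exist _ [::] Logic.I : {l | morley B l}).
have subS n : sublist (sval (S n)) (sval (S n.+1)).
  have [k1 [w [k2 [-> _ s2]]]] := nextP (S n) [::] _ erefl.
  rewrite -[sval (S n)]/([::] ++ _); apply: sublist_cat; last exact: sublist_skip.
  by elim: (k1) => [|z k IHk]; constructor.
(* Level [n]: elements that fill a cut of the sequence [S n] and keep it Morley. *)
pose X n (v : 'I_1 -> U) := exists l1 l2, sval (S n) = l1 ++ l2 /\
  morley B (l1 ++ v ord0 :: l2).
apply: (@no_perfect_chain _ _ _ _ _ _ C_hom D_tt 1 (fun n => B ++ sval (S n)) X
  _ _ _ _ 0 (fun=> x)).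
- by move=> n u; rewrite !ls_cat => -[|/(sublist_In (subS n))]; [left|right].
- by move=> n u; rewrite ls_cat => -[/BM|/(morley_sub (svalP (S n)))] /MC.
- move=> n v [l1 [l2 [_ /morley_sub lM]]] i; apply: MC; apply: lM.
  by rewrite (ord1 i); apply/List.in_app_iff; right; left.
- move=> n v [l1 [l2 [Sn vB]]].
  have [k1 [w [k2 [Sn1 s1 s2]]]] := nextP (S n) l1 l2 Sn.
  have kB : morley B (k1 ++ w :: k2) by rewrite -Sn1; apply: svalP.
  (* The next level has [w] in the given cut; [v1] is put just before [w] and [v2] just after it, so
     both fill the old cut. *)
  have [v1 v1B] := morley_insert kB.
  have [|v2 v2B] := @morley_insert (k1 ++ [:: w]) k2; first by rewrite -catA.
  rewrite -catA /= in v2B.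
  have agree v' : morley B (l1 ++ v' :: l2) ->
      simt (ls (B ++ sval (S n))) v (fun _ : 'I_1 => v').
    move=> v'B; have : el (zipr B (l1 ++ v ord0 :: l2) (l1 ++ v' :: l2)).
      by apply: morley_el => //; rewrite !size_cat.
    move=> elv; apply: el_sub elv _ => u u'; rewrite /zipr zip_cat //=.
    have zz (l : seq U) z : List.In z l -> List.In (z, z) (zip l l).
      by elim: l => //= t l IH [->|/IH]; [left|right].
    rewrite ls_cat Sn ls_cat => -[[[Bu|[lu|lu]] <-]|[i [-> ->]]].
    + by left.
    + by right; apply/List.in_app_iff; left; apply: zz.
    + by right; apply/List.in_app_iff; right; right; apply: zz.
    + by right; apply/List.in_app_iff; right; left; rewrite (ord1 i).
  exists (fun=> v1), (fun=> v2); split.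
  + split; [exists k1, (w :: k2)|exists (k1 ++ [:: w]), k2]; split=> //.
      by rewrite Sn1 -catA.
    by rewrite -catA.
  + apply: agree; apply: morley_sublist v1B.
    by apply: sublist_cat s1 _; apply: sublist_keep; apply: sublist_skip.
  + apply: agree; apply: morley_sublist v2B.
    by apply: sublist_cat s1 _; apply: sublist_skip; apply: sublist_keep.
  (* If [v1] and [v2] agreed over [w], then (y, x) would go to (v1, w), to (v2, w), and on to (x,
     y), because [:: w; v2] is Morley. *)
  + move=> /simtP v12; apply: nswap.
    have mB1 : morley B [:: v1; w].
      apply: morley_sublist v1B; rewrite -[[:: v1; w]]/([::] ++ [:: v1; w]).
      apply: sublist_cat; first by elim: (k1) => [|z k IHk]; constructor.
      do 2 apply: sublist_keep.
      by elim: (k2) => [|z k IHk]; constructor.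
    have mB2 : morley B [:: w; v2].
      apply: morley_sublist v2B; rewrite -[[:: w; v2]]/([::] ++ [:: w; v2]).
      apply: sublist_cat; first by elim: (k1) => [|z k IHk]; constructor.
      do 2 apply: sublist_keep.
      by elim: (k2) => [|z k IHk]; constructor.
    have el1 := morley_el xyB mB1 erefl.
    have el2 := morley_el mB2 xyB erefl.
    have el3 : el (zipr B [:: y; x] [:: v2; w]).
      apply: el_comp el1 v12 _ => u z [[Bu <-]|[[<- <-]|[[<- <-]|//]]].
      * by exists u; left; split=> //; rewrite ls_cat; left.
      * by exists v1; [right; left|right].
      * exists w; first by right; right; left.
        left; split=> //; rewrite ls_cat Sn1 ls_cat; right; right; left.
        by [].
    apply: el_comp el3 el2 _ => u z [[Bu <-]|[[<- <-]|[[<- <-]|//]]].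
    * by exists u; left.
    * by exists v2; [right; left|right; right; left].
    * by exists w; [right; right; left|right; left].
- exists [::], [::]; split=> //=.
  by case: xyB.
Qed.

(** [c] over [y] goes to [c] over [x] by the swap and non-splitting, hence to [y] over [x]; the swap
    turns this into [x] over [y]. *)
Lemma independence_sym x y : M x -> sim (ls B) c x -> M y ->
  sim (ls (B ++ [:: x])) c y -> sim (ls (B ++ [:: y])) c x.
Proof.
move=> Mx cx My cy; have swap : el (zipr B [:: y; x] [:: x; y]).
  by apply: morley_swap; rewrite /= cats0.
have elc : el (add (zipr B [:: y] [:: x]) c c).
  apply: zipr_add.
  - by move=> u [<-|].
  - by move=> u [<-|].
  - by apply: el_sub swap _ => u v [|[|]] //; [left|right; left].
have elx : el (add (zipr B [:: y] [:: x]) c y).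
  apply: el_comp elc cy _ => u v [[[Bu <-]|[[<- <-]|//]]|[-> ->]].
  - by exists u; [left; left|left; split=> //; rewrite ls_cat; left].
  - by exists x; [left; right; left|left; split=> //; rewrite ls_cat; right; left].
  - by exists c; right.
apply: el_comp elx (el_inv swap) _ => u v [[+ <-]|[-> ->]]; last first.
  by exists y; [right|right; right; left].
rewrite ls_cat => -[Bu|[<-|//]].
  by exists u; [left; left|left].
by exists x; [left; right; left|right; left].
Qed.

End Base.

(** * Morley sequences as indiscernible sets *)

Section IndiscernibleSet.

Variables (K : eqType) (prec : K -> K -> Prop) (s : K -> U).
Hypothesis prec_trans : forall x y z, prec x y -> prec y z -> prec x z.
Hypothesis prec_total : forall x y, x != y -> prec x y \/ prec y x.
Hypothesis s_M : forall z, M (s z).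
Hypothesis s_gen : forall z, sim (ls b `|` [set s z' | z' in prec^~ z]) c (s z).

(** Induction on the size of [l]. If the greatest index [m] of [z :: l] is [z], this is [s_gen];
    otherwise [s m] is generic over [s z] and the rest, and symmetry exchanges the two. *)
Lemma morley_generic l z : z \notin l -> sim (ls (b ++ map s l)) c (s z).
Proof.
have maxP (w : K) k : exists2 m, m \in w :: k & forall v, v \in w :: k ->
    v = m \/ prec v m.
  elim: k w => [|v k IH] w.
    by exists w; rewrite ?mem_head // => v; rewrite inE => /eqP ->; left.
  have [m mk mmax] := IH v.
  have [e|/prec_total[wm|mw]] := eqVneq w m.
  - exists w; rewrite ?mem_head // => u; rewrite inE => /orP[/eqP ->|].
      by left.
    by rewrite e => /mmax.
  - exists m; first by rewrite inE mk orbT.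
    by move=> u; rewrite inE => /orP[/eqP ->|/mmax //]; right.
  - exists w; rewrite ?mem_head // => u; rewrite inE => /orP[/eqP ->|/mmax].
      by left.
    by move=> [->|um]; right=> //; apply: prec_trans um mw.
have [n] := ubnP (size l); elim: n l z => // n IH l z; rewrite ltnS => ln zl.
have [m mzl mmax] := maxP z l.
have [em|mz] := eqVneq m z.
  rewrite em in mmax; apply: sim_sub (@s_gen z) _; rewrite ls_cat.
  move=> u [bu|/List.in_map_iff[v [<- /List_InP vl]]]; first by left.
  right; exists v => //=; have [|ev|//] := mmax v; first by rewrite inE vl orbT.
  by move: zl; rewrite -ev vl.
have ml : m \in l by move: mzl; rewrite inE (negbTE mz).
pose l' := filter (predC1 m) l.
have l'n : (size l' < n)%N.
  apply: leq_trans ln; rewrite size_filter -(count_predC (pred1 m) l).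
  rewrite -[X in (X < _)%N]add0n ltn_add2r -has_count.
  by apply/hasP; exists m => //=.
have zl' : z \notin l' by rewrite mem_filter negb_and zl orbT.
have := @independence_sym (b ++ map s l') _ _ (s z) (s m) (s_M z) (IH _ _ l'n zl')
  (s_M m) _.
move=> H; apply: sim_sub (H _ _ _) _.
- by rewrite ls_cat => u; left.
- by rewrite ls_cat => u [/bM //|/List.in_map_iff[v [<- _]]].
- apply: sim_sub (@s_gen m) _; rewrite !ls_cat.
  move=> u [[bu|/List.in_map_iff[v [<- /List_InP vl]]]|[<-|//]]; first by left.
    right; exists v => //=; move: vl; rewrite mem_filter => /andP[/= vm vl].
    have [|ev|//] := mmax v; first by rewrite inE vl orbT.
    by rewrite ev eqxx in vm.
  right; exists z => //=; have [|ev|//] := mmax z; first by rewrite mem_head.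
  by rewrite ev eqxx in mz.
rewrite !ls_cat => u [bu|/List.in_map_iff[v [<- /List_InP vl]]]; first by left; left.
have [->|vm] := eqVneq v m; first by right; left.
left; right; apply/List.in_map_iff; exists v; split=> //.
by apply/List_InP; rewrite mem_filter /= vm.
Qed.

Lemma morley_uniq l : uniq l -> morley b (map s l).
Proof.
by elim: l => //= z l IH /andP[/morley_generic zl /IH lb].
Qed.

End IndiscernibleSet.

(* Otherwise, by indiscernibility, E has conjugates that treat any prescribed
   elements of an initial segment of [s \o inl] like [s (inl _)] and the others
   like [s (inr _)]. *)
Lemma indiscernible_average (s : nat + nat -> U) (E : seq U) :
  (forall l, uniq l -> morley b (map s l)) -> ls E `<=` M ->
  (forall j, ~ sim (ls E) c (s (inl j))) ->
  (forall j, sim (ls E) c (s (inr j))) -> False.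
Proof.
move=> s_morley EM bad good.
pose a (i : 'I_(size E)) := nth c E i.
have aM i : M (a i).
  by apply: EM; rewrite /a; elim: E i {bad good a} => [|x l IH] [[|k] //= kE];
     [left|right; apply: (IH (Ordinal (kE : k < size l)%N))].
have aE x : List.In x E -> exists i, x = a i.
  by move=> /In_nth[k kE kx]; exists (Ordinal kE); rewrite /a kx.
pose g k : seq (nat + nat) := [seq inl j | j <- rev (iota 0 k)].
have gS k : g k.+1 = inl k :: g k.
  by rewrite /g -addn1 iotaD rev_cat add0n.
have g_uniq k : uniq (g k).
  by rewrite map_inj_uniq ?rev_uniq ?iota_uniq // => ? ? [].
have g_size k : size (g k) = k by rewrite size_map size_rev size_iota.
pose F k := map s (g k).
pose zp l m (x y : U) := List.In (x, y) (zip l m).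
(* Level [k]: tuples that stand to the first [k] elements of [s \o inl] as [a] stands to some [k]
   distinctly indexed members. *)
pose X k (x : 'I_(size E) -> U) := (forall i, C (x i)) /\
  exists l, [/\ uniq l, size l = k & el (ext (zp (F k) (map s l)) x a)].
apply: (@no_perfect_chain _ _ _ _ _ _ C_hom D_tt _ F X _ _ _ _ 0 a).
- by move=> k y; rewrite /F gS; right.
- move=> k y /List.in_map_iff[z [<- _]]; apply: MC.
  by have [] : morley b (map s [:: z]) by apply: s_morley.
- by move=> k x [].
- move=> k x [Cx [l [l_uniq lk elx]]].
  have fresh (f : nat -> nat + nat) : injective f -> exists j, f j \notin l.
    move=> f_inj; apply: contrapT => nj.
    have sub : {subset [seq f j | j <- iota 0 (size l).+1] <= l}.
      move=> _ /mapP[j _ ->]; apply: contrapT => /negP fj.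
      by apply: nj; exists j.
    have := uniq_leq_size _ sub.
    rewrite map_inj_uniq // iota_uniq size_map size_iota ltnn => /(_ isT).
    by [].
  have extend z : z \notin l -> exists2 x1, (forall i, C (x1 i)) &
      el (ext (zp (F k.+1) (map s (z :: l))) x1 a).
    move=> zl; pose R u v := zp (F k.+1) (map s (z :: l)) v u.
    have elR : el R.
      have : el (zipr b (F k.+1) (map s (z :: l))).
        apply: morley_el => //.
        - by apply: s_morley.
        - by apply: s_morley; rewrite /= zl.
        - by rewrite /F !(size_map s) g_size /= lk.
      move=> /el_inv elz; apply: el_sub elz _ => u v; by right.
    have RM u v : R u v -> M u /\ M v.
      move=> H; have [vF ul] := zip_InP H.
      have [p _ ->] := In_map vF; have [q _ ->] := In_map ul.
      have [] : morley b (map s [:: q]) by apply: s_morley.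
      by have [] : morley b (map s [:: p]) by apply: s_morley.
    have RC u v : R u v -> C u /\ C v by move=> /RM[/MC ? /MC].
    have fin : finR R.
      exists (F k.+1 ++ map s (z :: l)) => u v H; have [? ?] := zip_InP H.
      by rewrite !List.in_app_iff; auto.
    have [|x1 Cx1 el1] := homogeneous_ext C_hom (u := a) C_hom elR RC
      (finR_ran chi_inf fin).
      by move=> i; apply: MC; apply: aM.
    exists x1 => //; apply: el_sub (el_inv el1) _ => u v [|[i [-> ->]]].
      by left.
    by right; exists i.
  have agree z x1 : el (ext (zp (F k.+1) (map s (z :: l))) x1 a) ->
      simt (ls (F k)) x x1.
    move=> el1; apply: el_comp elx (el_inv el1) _ => u v [[Fu <-]|[i [-> ->]]].
      have [|w uw] := @zip_In_exists _ (F k) (map s l) u _ Fu.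
        by rewrite /F !(size_map s) g_size lk.
      by exists w; left => //; rewrite /zp /F gS /=; right.
    by exists (a i); right; exists i.
  have [j jl] := fresh inl (@inl_inj _ _).
  have [j' jl'] := fresh inr (@inr_inj _ _).
  have [x1 Cx1 el1] := extend _ jl; have [x2 Cx2 el2] := extend _ jl'.
  exists x1, x2; split.
  + split; split=> //; [exists (inl j :: l)|exists (inr j' :: l)];
    by split; rewrite /= ?jl ?jl' ?lk.
  + exact: agree el1.
  + exact: agree el2.
  (* [s (inl k)] stands to [x1] as a bad member stands to [a], and to [x2] as a good one does; if
     [x1] and [x2] agreed, the two members would have the same type over [E]. *)
  + move=> x12.
    have F0 : List.In (s (inl k)) (F k.+1) by rewrite /F gS; left.
    have el3 : el (ext (fun u v => u = s (inl j) /\ v = s (inl k)) a x2).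
      apply: el_comp (el_inv el1) x12 _ => u v [[-> ->]|[i [-> ->]]].
        exists (s (inl k)); last by left.
        by left; rewrite /zp /F gS; left.
      by exists (x1 i); right; exists i.
    have el4 : sim (ls E) (s (inl j)) (s (inr j')).
      apply: el_comp el3 el2 _ => u v [[/aE[i ->] <-]|[-> ->]].
        by exists (x2 i); right; exists i.
      exists (s (inl k)); first by left.
      by left; rewrite /zp /F gS; left.
    exact: (bad j (sim_trans (good j') (sim_sym el4))).
- split; first by move=> i; apply: MC.
  exists [::]; split=> //.
  by apply: el_sub (@simt_refl _ _ I set0 _ a) _ => u v [//|]; right.
Qed.

End Morley.

(** * Strict well-orders *)

Definition swo (X : Type) (R : X -> X -> Prop) : Prop :=
  [/\ forall A : set X, A !=set0 -> exists2 z, A z & forall x, A x -> ~ R x z,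
      forall x y z, R x y -> R y z -> R x z,
      forall x y, [\/ R x y, x = y | R y x] &
      forall x, ~ R x x].

Definition lex (X Y : Type) (R : X -> X -> Prop) (S : Y -> Y -> Prop)
    (p q : X * Y) : Prop :=
  R p.1 q.1 \/ p.1 = q.1 /\ S p.2 q.2.

Lemma swo_lex X Y (R : X -> X -> Prop) (S : Y -> Y -> Prop) :
  swo R -> swo S -> swo (lex R S).
Proof.
move=> [Rmin Rtr Rtot Rirr] [Smin Str Stot Sirr]; split.
- move=> A [[x y] Axy].
  have [|x0 [y0 A0] x0min] := Rmin [set x | exists y, A (x, y)].
    by exists x, y.
  have [|y1 A1 y1min] := Smin [set y | A (x0, y)]; first by exists y0.
  exists (x0, y1) => // -[x' y'] A' [/= xx|/= [ex yy]].
    by apply: x0min xx; exists y'.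
  by apply: y1min yy; rewrite /= -ex.
- move=> [x1 x2] [y1 y2] [z1 z2] [/= xy|/= [-> xy]] [/= yz|/= [<- yz]].
  + by left; apply: Rtr xy yz.
  + by left.
  + by left.
  + by right; split=> //; apply: Str xy yz.
- move=> [x1 x2] [y1 y2]; have [xy|->|yx] := Rtot x1 y1.
  + by constructor 1; left.
  + have [xy|->|yx] := Stot x2 y2.
    * by constructor 1; right.
    * by constructor 2.
    * by constructor 3; right.
  + by constructor 3; left.
- by move=> [x y] [/Rirr|[_ /Sirr]].
Qed.

Lemma swo_nat : swo (fun m n : nat => (m < n)%N).
Proof.
split.
- move=> A [n An]; have [|m /asboolP Am mmin] := @ex_minnP (fun n => `[< A n >]).
    by exists n; apply/asboolP.
  by exists m => // k /asboolP/mmin mk; rewrite ltnNge mk.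
- by move=> x y z; apply: ltn_trans.
- by move=> x y; case: (ltngtP x y) => H; [constructor 1|constructor 3|constructor 2].
- by move=> x; rewrite ltnn.
Qed.

Lemma swo_wf X (R : X -> X -> Prop) : swo R -> well_founded R.
Proof.
move=> [Rmin _ _ _] x; apply: contrapT => nx.
have [|z nz zmin] := Rmin [set x | ~ Acc R x]; first by exists x.
by apply: nz; constructor=> y Ryz; apply: contrapT => /zmin.
Qed.

(** Recursion with a choice at each step. [P i] depends on the values below [i] only, so the others
    may be filled with [x0] before [i] is reached. *)
Lemma wf_choice (K X : Type) (R : K -> K -> Prop) (x0 : X)
    (P : K -> (K -> X) -> X -> Prop) :
  swo R ->
  (forall i f g x, (forall j, R j i -> f j = g j) -> P i f x -> P i g x) ->
  (forall i f, (forall j, R j i -> P j f (f j)) -> exists x, P i f x) ->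
  exists f, forall i, P i f (f i).
Proof.
move=> Rwo Pext Pstep; have Rwf := swo_wf Rwo; have [_ Rtr _ _] := Rwo.
have /choice[F FP] (p : K * (K -> X)) :
    exists x, (exists x, P p.1 p.2 x) -> P p.1 p.2 x.
  have [[x Px]|nx] := pselect (exists x, P p.1 p.2 x); first by exists x.
  by exists x0.
pose G i (h : forall j, R j i -> X) :=
  F (i, fun j => if pselect (R j i) is left r then h j r else x0).
pose f := Fix Rwf (fun _ => X) G.
pose g i j := if pselect (R j i) then f j else x0.
have fE i : f i = F (i, g i).
  rewrite /f Fix_eq; last first.
    by move=> j h h' hh; congr (F (_, _)); apply/funext => k; case: pselect.
  by congr (F (_, _)); apply/funext => j; rewrite /g; case: pselect.
have gE i j : R j i -> g i j = f j by rewrite /g; case: pselect.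
exists f => i; elim/(well_founded_ind Rwf): i => i IH.
apply: (Pext _ (g i)) => [j /gE //|]; rewrite fE.
apply: (FP (i, g i)) => /=; apply: Pstep => j Rji; rewrite gE //.
by apply: Pext (IH _ Rji) => k Rkj; rewrite gE //; apply: Rtr Rkj Rji.
Qed.

Lemma swo_well_order X (R : X -> X -> Prop) : swo R ->
  well_order (fun x y : X => `[< R x y \/ x = y >]).
Proof.
move=> [Rmin Rtr Rtot Rirr] A [x Ax].
have [|z Az zmin] := Rmin (fun x => x \in A); first by exists x.
have zle y : y \in A -> R z y \/ z = y.
  by move=> /zmin nyz; have [|->|//] := Rtot z y; [left|right].
exists z; split; first by split=> // y /zle ?; apply/asboolP.
move=> w [Aw wmin]; have [zw|//] := zle _ Aw.
have /asboolP[wz|//] := wmin z Az.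
by case: (Rirr z); apply: Rtr zw wz.
Qed.

Section Diagram.

Variables (L : language) (U : Type) (I : interp L U).
Variables (D : forall n, set (set (fmla L 'I_n))) (chi : Type) (C : set U).
Hypothesis C_hom : homogeneous I D chi C chi C.
Hypothesis chi_inf : infinite_set [set: chi].

Local Notation el := (el I).
Local Notation sim := (sim I).
Local Notation simt := (simt I).

(** * Elementary submodels *)

Lemma submodel_sat (N : set U) (J : interp L {x : U | N x}) :
  (forall n (phi : fmla L 'I_n) (v : 'I_n -> {x : U | N x}),
      sat J v phi <-> sat I (fun i => sval (v i)) phi) ->
  forall V (phi : fmla L V) (v : V -> {x : U | N x}),
    sat J v phi <-> sat I (fun i => sval (v i)) phi.
Proof.
move=> JE V phi v; have [K [e [psi [<- _]]]] := fmla_support phi.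
pose w (k : 'I_#|K|) := v (e (enum_val k)).
have E (W : Type) (J' : interp L W) (u : V -> W) : sat J' u (fmap e psi) <->
    sat J' (fun k => u (e (enum_val k))) (fmap (@enum_rank K) psi).
  rewrite !sat_fmap.
  suff -> : (fun k => u (e (enum_val k))) \o enum_rank = u \o e by [].
  by apply/funext => k /=; rewrite enum_rankK.
by rewrite !E; apply: JE.
Qed.

(** Tarski-Vaught test: a witness exists in [C], which is elementary, and is moved into [M] over the
    finitely many values of the free variables. *)
Lemma omega_submodel (M : set U) : M `<=` C ->
  (forall l c, ls l `<=` M -> C c -> exists2 u, M u & sim (ls l) c u) ->
  elementary_submodel I M.
Proof.
move=> MC M_omega; have [[[JC JCE] _ _] _] := C_hom.
have witness V (phi : fmla L (option V)) (v : V -> U) x : (forall i, M (v i)) ->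
    sat I (fun o => if o is Some y then v y else x) phi ->
    exists2 u, M u & sat I (fun o => if o is Some y then v y else u) phi.
  move=> Mv xphi.
  have Cv i : C (v i) by apply: MC.
  pose vC i : {x | C x} := exist _ (v i) (Cv i).
  have : sat I (fun i => sval (vC i)) (Ex phi) by exists x.
  move=> /(submodel_sat JCE)[[y Cy] yphi0].
  have yphi := (submodel_sat JCE phi _).1 yphi0.
  have {}yphi : sat I (fun o => if o is Some z then v z else y) phi.
    move: yphi; suff -> : (fun i => sval
      (if i is Some z then vC z else exist _ y Cy)) =
      (fun o => if o is Some z then v z else y) by [].
    by apply/funext => -[].
  have [K [e [psi [ephi _]]]] := fmla_support phi.
  have [l lM lfree] : exists2 l, ls l `<=` M &
      forall z, free phi (Some z) -> List.In (v z) l.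
    have [l' _ l'P] : exists2 l', ls l' `<=` [set: option V] &
        forall o, free phi o -> List.In o l'.
      exists [seq e k | k <- enum K] => // o; rewrite -ephi => fo.
      have [k _ ->] := free_fmap fo.
      by apply/List.in_map_iff; exists k; split=> //; apply/List_InP; rewrite mem_enum.
    exists (pmap (omap v) l').
      elim: l' {l'P} => [|[z|] l' IH] u //=.
        by case=> [<-|H]; [exact: Mv|exact: IH].
      exact: IH.
    move=> z /l'P; elim: l' {l'P} => [|[w|] l' IH] //=.
      by move=> [[->]|/IH]; [left|right].
    by move=> [|/IH].
  have [u Mu yu] := M_omega l y lM Cy; exists u => //.
  apply: (el_sat yu _).1 yphi => -[z|] fz /=; last by right.
  by left; split=> //; apply: lfree.
have fun_M (f : lfun L) (a : 'I_(fun_ar f) -> {x | M x}) :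
    M (ifun I (f := f) (fun i => sval (a i))).
  have [|u Mu /= <-] := @witness _ (Eq (Var L None) (App (fun i => Var L (Some i))))
    (fun i => sval (a i)) (ifun I (f := f) (fun i => sval (a i))) _ erefl.
    by move=> i; case: (a i).
  by [].
exists (Interp (fun f a => exist _ _ (fun_M f a))
               (fun r a => irel I (fun i => sval (a i)))).
set J := Interp _ _.
have tevalE V (t : term L V) v : sval (teval J v t) = teval I (fun i => sval (v i)) t.
  by elim: t => //= f ts IH; congr ifun; apply/funext => i; apply: IH.
suff satE V (phi : fmla L V) v : sat J v phi <-> sat I (fun i => sval (v i)) phi.
  by move=> n; apply: satE.
elim: phi v => {V} /= [V t u|V r ts|V f IH|V f IHf h IHh|V f IH] v.
- rewrite -!tevalE; split=> [-> //|e].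
  by case: (teval J v t) (teval J v u) e => [x px] [y py] /= e; apply: eq_exist.
- by under eq_fun do rewrite tevalE.
- by rewrite IH.
- by rewrite IHf IHh.
- have E x : (fun i => sval (if i is Some y then v y else x)) =
      (fun o => if o is Some y then sval (v y) else sval x).
    by apply/funext => -[].
  split=> [[x]|[x xf]]; first by rewrite IH E; exists (sval x).
  have [|u Mu uf] := @witness _ f (fun i => sval (v i)) x _ xf.
    by move=> i; case: (v i).
  by exists (exist _ u Mu); rewrite IH E.
Qed.

(** * Construction *)

Hypothesis D_tt : totally_transcendental I D C.

Variables (A : set U) (mu Lam : Type) (c0 : U).
Hypothesis A_sub : A `<=` C.
Hypothesis mu_inf : infinite_set [set: mu].
Hypothesis A_le : A #<= [set: Lam].
Hypothesis mu_le : [set: mu] #<= [set: Lam].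
Hypothesis D_le : total_set D #<= [set: Lam].
Hypothesis Lam_lt : [set: Lam] #< [set: chi].
Hypothesis Cc0 : C c0.

Variables (Rmu : mu -> mu -> Prop) (RLam : Lam -> Lam -> Prop).
Hypothesis Rmu_wo : swo Rmu.
Hypothesis Rmu_initial : forall x, [set y | Rmu y x] #< [set: mu].
Hypothesis RLam_wo : swo RLam.

Lemma Lam_inf : infinite_set [set: Lam].
Proof. by apply: contra_not mu_inf; apply: card_le_finite. Qed.

Let stage := (nat * mu)%type.
Let K := (stage * Lam)%type.
Let Rst : stage -> stage -> Prop := lex (fun m n : nat => (m < n)%N) Rmu.
Let RK : K -> K -> Prop := lex Rst RLam.

Let Rst_wo : swo Rst. Proof. exact: swo_lex swo_nat Rmu_wo. Qed.
Let RK_wo : swo RK. Proof. exact: swo_lex Rst_wo RLam_wo. Qed.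

Lemma K_le : [set: K] #<= [set: Lam].
Proof.
have nat_le : [set: nat] #<= [set: Lam] by apply/infiniteP/Lam_inf.
by do 2 apply: (card_prodT Lam_inf) => //.
Qed.

Definition below (f : K -> U) (i : K) : set U := A `|` [set f j | j in RK^~ i].
Definition before (f : K -> U) (s : stage) : set U :=
  A `|` [set f j | j in [set j : K | Rst j.1 s]].

Definition isolated_at (X B : set U) (u : U) : Prop :=
  [/\ B `<=` X, B #< [set: mu] & forall v, C v -> sim B u v -> sim X u v].

Lemma card_AK (f : K -> U) (S : set K) : A `|` f @` S #<= [set: Lam].
Proof.
apply: card_unionT => //; first exact: Lam_inf.
apply: card_le_trans (card_image_le _ _) _.
exact: card_le_trans (card_leT _) K_le.
Qed.

(* At stage s every isolated type over [before f s] is realized, one at a time. *)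
Lemma exists_construction : exists f : K -> U,
  [/\ forall i, C (f i),
      forall i, exists B, isolated_at (below f i) B (f i) &
      forall s B c, B `<=` before f s -> B #< [set: mu] -> C c ->
        exists l, sim B c (f (s, l))].
Proof.
have /choice[E EP] (X : set U) : exists e : Lam -> U,
    X `<=` C -> X #<= [set: Lam] ->
    forall c, C c -> exists l, C (e l) /\ sim X (e l) c.
  have [[XC Xle]|nX] := pselect (X `<=` C /\ X #<= [set: Lam]).
    by have [e eP] := types_enumerable C_hom D_tt c0 Lam_inf D_le XC Xle; exists e.
  by exists (fun=> c0) => XC Xle; case: nX.
(* [E] lists the types over the earlier stages; index [i] serves the [i.2]-th of them if it is
   isolated, and otherwise takes any isolated element. *)
pose P i f u := [/\ C u, exists B, isolated_at (below f i) B u &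
  let e := E (before f i.1) i.2 in
  C e -> forall B, isolated_at (before f i.1) B e -> sim (before f i.1) e u].
have [f fP] : exists f, forall i, P i f (f i).
  have belowE i f g : (forall j, RK j i -> f j = g j) -> below f i = below g i.
    move=> fg; congr (_ `|` _); apply/seteqP.
    by split=> _ [j /[dup] ji /fg e <-]; exists j; rewrite // e.
  have beforeE i f g : (forall j, RK j i -> f j = g j) ->
      before f i.1 = before g i.1.
    move=> fg; congr (_ `|` _); apply/seteqP.
    by split=> _ [j /= ji <-]; exists j => //; rewrite fg //; left.
  apply: (wf_choice c0 RK_wo).
    move=> i f g u /[dup] /belowE eb /beforeE eb'.
    by rewrite /P eb eb'.
  move=> i f fP.
  have bC : below f i `<=` C by move=> y [/A_sub //|[j /fP[Cj _ _] <-]].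
  have bb : before f i.1 `<=` below f i.
    by move=> y [Ay|[j ji <-]]; [left|right; exists j => //; left].
  set e := E (before f i.1) i.2.
  have [[Ce [B [Bb Bmu eB]]]|ne] :=
      pselect (C e /\ exists B, isolated_at (before f i.1) B e).
    (* Density is applied over the set [B] that isolates [e]: agreement with [e] there extends to
       all earlier stages. *)
    have [u [B' [[Cu eu] BB' B'b B'mu uB']]] := isolated_dense C_hom D_tt mu_inf bC
      (subset_trans Bb bb) Bmu Ce.
    exists u; split=> //; first by exists B'.
    by move=> /= _ _ _; apply: eB.
  have [u [B' [[Cu eu] BB' B'b B'mu uB']]] := isolated_dense C_hom D_tt mu_inf bC
    (@sub0set _ _) (finite_card_lt mu_inf (finite_set0 _)) Cc0.
  exists u; split=> //; first by exists B'.
  by move=> /= Ce B eB; case: ne; split=> //; exists B.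
have Cf i : C (f i) by case: (fP i).
exists f; split=> //; first by move=> i; case: (fP i).
move=> s B c Bs Bmu Cc; set X := before f s in Bs.
have XC : X `<=` C by move=> y [/A_sub //|[j _ <-]].
(* The type of [c] over [X] need not be isolated, so [c] is replaced by some [c'] of isolated type
   with the same type over [B]. *)
have [c' [B' [[Cc' cc'] BB' B'X B'mu c'B']]] :=
  isolated_dense C_hom D_tt mu_inf XC Bs Bmu Cc.
have [l [Ce ec']] := EP X XC (card_AK _ _) c' Cc'.
have isoe : isolated_at X B' (E X l).
  split=> // v Cv ev; apply: (sim_trans ec'); apply: (c'B') => //.
  by apply: sim_trans (sim_sym (sim_sub ec' B'X)) ev.
have [_ _ /(_ Ce _ isoe)/= el_] := fP (s, l); exists l.
apply: sim_trans cc' _; apply: sim_sub Bs.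
by apply: sim_trans (sim_sym ec') el_.
Qed.

(** * Homogeneity and constructibility of the model *)

Variable f : K -> U.
Hypothesis Cf : forall i, C (f i).
Hypothesis f_iso : forall i, exists B, isolated_at (below f i) B (f i).
Hypothesis f_real : forall s B c, B `<=` before f s -> B #< [set: mu] -> C c ->
  exists l, sim B c (f (s, l)).

Definition model : set U := A `|` range f.

Lemma model_sub : model `<=` C.
Proof. by move=> y [/A_sub //|[j _ <-]]. Qed.

Lemma model_le : model #<= [set: Lam].
Proof. exact: card_AK. Qed.

Lemma model_before (l : seq U) : ls l `<=` model ->
  exists n, forall m j, (n <= m)%N -> ls l `<=` before f (m, j).
Proof.
elim: l => [|x l IH] lM; first by exists 0 => m j _ y [].
have [|n nl] := IH; first by move=> y ly; apply: lM; right.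
have [Ax|[[[k j'] la] _ fx]] := lM x (or_introl erefl).
  by exists n => m j nm y [<-|/(nl m j nm)//]; left.
exists (maxn n k.+1) => m j; rewrite geq_max => /andP[nm km] y [<-|].
  by right; exists ((k, j'), la) => //; left.
exact: nl.
Qed.

Lemma model_omega l c : ls l `<=` model -> C c ->
  exists2 u, model u & sim (ls l) c u.
Proof.
move=> /model_before[n nl] Cc; have [j0 _] := infinite_setN0 mu_inf.
have [|la cu] := f_real (nl n j0 (leqnn _)) _ Cc.
  by apply: finite_card_lt => //; apply: finite_ls.
by exists (f ((n, j0), la)) => //; right; exists ((n, j0), la).
Qed.

(* The set B may be cofinal in the construction, so tp(c, B) need not be
   realized at any single stage.  A Morley sequence of length mu in the type of
   c over the model is built inside one block; each finite tuple of B excludes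
   only finitely many of its members. *)
Lemma model_realizes B c : B `<=` model -> B #< [set: mu] -> C c ->
  exists2 u, model u & sim B c u.
Proof.
move=> BM Bmu Cc; have [/finite_set_ls[l Bl]|Binf] := pselect (finite_set B).
  by rewrite Bl in BM *; apply: model_omega.
have [b bM b_ns] := exists_nonsplitting C_hom chi_inf D_tt model_sub model_omega Cc.
have [n nb] := model_before bM; have [j0 _] := infinite_setN0 mu_inf.
(* Proper initial segments of [Rmu] are smaller than mu, so [f_real] applies at every stage of block
   [n]. *)
have [d dP] : exists d : mu -> U, forall j, (exists l, d j = f ((n, j), l)) /\
    sim (ls b `|` [set d i | i in Rmu^~ j]) c (d j).
  apply: (wf_choice c0 Rmu_wo
    (P := fun j d u => (exists l, u = f ((n, j), l)) /\
       sim (ls b `|` [set d i | i in Rmu^~ j]) c u)).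
    move=> j d d' u dd' [ju cu]; split=> //; apply: sim_sub cu _.
    by move=> y [by_|[i /[dup] /= ij /dd' <- <-]]; [left|right; exists i].
  move=> j d dP.
  have [| |l cl] := @f_real (n, j) (ls b `|` [set d i | i in Rmu^~ j]) c _ _ Cc.
  - move=> y [/(nb n j (leqnn _)) //|[i ij <-]].
    have [[l ->] _] := dP i ij.
    by right; exists ((n, i), l) => //; right.
  - apply: card_lt_union => //; first by apply: finite_card_lt => //; apply: finite_ls.
    exact: card_lt_le (card_image_le _ _) (Rmu_initial j).
  by exists (f ((n, j), l)); split=> //; exists l.
have dM j : model (d j).
  by have [[l ->] _] := dP j; right; exists ((n, j), l).
have nat_lt : [set: nat] #< [set: mu].
  by apply: card_lt_le Bmu; apply/infiniteP.
pose bad a j := ~ sim (ls (b ++ a)) c (d j).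
have bad_fin a : ls a `<=` B -> finite_set [set j | bad a j].
  move=> aB; apply: contrapT => /infiniteP.
  have baM : ls (b ++ a) `<=` model by rewrite ls_cat => y [/bM|/aB/BM].
  rewrite -(card_le_eqr (card_setT _)) => /card_le_injTP[h0 h0_inj].
  pose h k := \val (h0 k).
  have h_bad k : bad a (h k) by apply: (set_valP (h0 k)).
  have h_inj : injective h by move=> k k' /val_inj/h0_inj.
  have [n' n'ba] := model_before baM; pose n1 := maxn n.+1 n'.
  (* The appended members, generic over [a] and the bad [d (h i)]; they come from blocks after [n],
     where all [d j] are available. *)
  have [e eP] : exists e : nat -> U, forall k,
      (exists l, e k = f ((n1 + k, j0), l)) /\
      sim (ls (b ++ a) `|` range (d \o h) `|` [set e i | i in [set i | (i < k)%N]])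
        c (e k).
    apply: (wf_choice c0 swo_nat (P := fun k e u =>
      (exists l, u = f ((n1 + k, j0), l)) /\ sim (ls (b ++ a) `|` range (d \o h)
        `|` [set e i | i in [set i | (i < k)%N]]) c u)).
      move=> k e e' u ee' [ku cu]; split=> //; apply: sim_sub cu _.
      by move=> y [by_|[i /[dup] /= ij /ee' <- <-]]; [left|right; exists i].
    move=> k e eP.
    have [| |l cl] := @f_real (n1 + k, j0) (ls (b ++ a) `|` range (d \o h)
        `|` [set e i | i in [set i | (i < k)%N]]) c _ _ Cc.
    - move=> y [[bay|[i _ <-]]|[i ik <-]].
      + apply: n'ba bay; apply: leq_trans (leq_addr _ _); exact: leq_maxr.
      + have [[l /= ->] _] := dP (h i); right; exists ((n, h i), l) => //; left.
        exact: leq_trans (leq_maxl n.+1 n') (leq_addr _ _).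
      + have [[l ->] _] := eP i ik; right; exists ((n1 + i, j0), l) => //; left.
        by rewrite /= ltn_add2l.
    - apply: card_lt_union => //; first apply: card_lt_union => //.
      + by apply: finite_card_lt => //; apply: finite_ls.
      + exact: card_lt_le (card_image_le _ _) nat_lt.
      + apply: card_lt_le nat_lt; apply: card_le_trans (card_image_le _ _) _.
        exact: card_leT.
    by exists (f ((n1 + k, j0), l)); split=> //; exists l.
  have eM k : model (e k).
    by have [[l ->] _] := eP k; right; exists ((n1 + k, j0), l).
  pose s (z : nat + nat) := match z with inl k => d (h k) | inr k => e k end.
  pose prec (y z : nat + nat) : Prop := match y, z with
    | inl i, inl k => Rmu (h i) (h k)
    | inl _, inr _ => True
    | inr _, inl _ => False
    | inr i, inr k => (i < k)%N
    end.
  have [_ Rmu_tr Rmu_tot _] := Rmu_wo.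
  apply: (indiscernible_average C_hom chi_inf D_tt model_sub bM b_ns
    (s := s) (E := b ++ a)) => //.
  - apply: (morley_uniq C_hom chi_inf D_tt model_sub model_omega Cc bM b_ns
      (prec := prec)).
    + by move=> [x|x] [y|y] [z|z] //=; [apply: Rmu_tr|apply: ltn_trans].
    + move=> [x|x] [y|y] //= xy; [|by left|by right|].
        have [|/h_inj e_|] := Rmu_tot (h x) (h y); [by left| |by right].
        by rewrite e_ eqxx in xy.
      by apply/orP; rewrite -neq_ltn; apply: contraNneq xy => ->.
    + by move=> [k|k]; [apply: dM|apply: eM].
    + move=> [k|k] /=.
        have [_ dk] := dP (h k); apply: sim_sub dk _ => y [by_|[[i|i] //= ik <-]].
          by left.
        by right; exists (h i).
      have [_ ek] := eP k; apply: sim_sub ek _ => y [by_|[[i|i] //= ik <-]].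
      * by left; left; rewrite ls_cat; left.
      * by left; right; exists i.
      * by right; exists i.
  - by move=> k; have [_ ek] := eP k; apply: sim_sub ek _ => y; left; left.
(* An index in [N] is determined by a finite tuple of [B] and a number, so |N| is at most |B|. *)
pose N := [set j | exists2 a, ls a `<=` B & bad a j].
have N_lt : N #< [set: mu].
  apply: card_lt_le Bmu.
  have BTinf : infinite_set [set: B].
    by apply: contra_not Binf; apply: card_le_finite; rewrite (card_le_eqr (card_setT B)).
  rewrite -(card_le_eqr (card_setT B)).
  have [x0 _] := infinite_setN0 BTinf.
  have [hB hB_inj] : exists hB : U -> B, forall x y, B x -> B y -> hB x = hB y -> x = y.
    by apply: (card_le_injP _ x0).1; rewrite (card_le_eqr (card_setT B)).
  have /choice[g gP] (a : seq U) : exists g : mu -> nat, ls a `<=` B ->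
      forall i j, bad a i -> bad a j -> g i = g j -> i = j.
    have [aB|naB] := pselect (ls a `<=` B); last by exists (fun=> 0).
    have [g g_inj] := (card_le_injP [set j | bad a j] 0).1
      (finite_set_countable (bad_fin a aB)).
    by exists g.
  have /choice[a aP] j : exists a, N j -> ls a `<=` B /\ bad a j.
    by have [[a aB aj]|] := pselect (N j); [exists a|exists [::]].
  have prod_le : [set: seq B * nat] #<= [set: B].
    by apply: card_prodT => //; [apply: card_seqT|apply/infiniteP].
  apply: card_le_trans prod_le; apply/(card_le_injP _ ([::], 0)).
  exists (fun j => (map hB (a j), g (a j) j)) => i j Ni Nj [].
  have [aiB badi] := aP i Ni; have [ajB badj] := aP j Nj.
  move=> eij; have {}eij : a i = a j.
    elim: (a i) (a j) aiB ajB eij => [|x k IH] [|y m] //= kB mB [exy ekm].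
    congr (_ :: _); first by apply: hB_inj exy; [apply: kB|apply: mB]; left.
    by apply: IH ekm => z ?; [apply: kB|apply: mB]; right.
  by rewrite eij in badi *; apply: gP.
have [j Nj] : exists j, ~ N j.
  apply: contrapT => /forallNP Nall; apply: N_lt.2.
  by apply: subset_card_le => j _; apply: contrapT; apply: Nall.
exists (d j) => //; apply: sim_fin => l lB.
have : sim (ls (b ++ l)) c (d j).
  by apply: contrapT => badj; apply: Nj; exists l.
by move=> bl; apply: sim_sub bl _; rewrite ls_cat => y; right.
Qed.

(** The tail is realized in the model, homogeneity of [C] carries the head along to [v], and [v] is
    realized over [B] and the new tail. *)
Lemma model_realizes_tuple B n (c : 'I_n -> U) : B `<=` model ->
  B #< [set: mu] -> (forall i, C (c i)) ->
  exists2 u, (forall i, model (u i)) & simt B c u.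
Proof.
move=> BM Bmu; elim: n c => [|n IH] c Cc.
  by exists c; [case|exact: simt_refl].
have [|u' Mu' cu'] := IH (c \o lift ord0); first by move=> i; apply: Cc.
set R := ext (diag B) (c \o lift ord0) u'.
have RM x y : R x y -> C x /\ model y.
  move=> [[Bx <-]|[i [-> ->]]]; first by split; [apply/model_sub|]; apply: BM.
  by split; [apply: Cc|].
have RanE : [set y | exists x, R x y] `<=` B `|` range u'.
  by move=> y [x [[Bx <-]|[i [_ ->]]]]; [left|right; exists i].
have ran_lt : [set y | exists x, R x y] #< [set: mu].
  apply: card_lt_le (subset_card_le RanE) _; apply: card_lt_union => //.
  by apply: finite_card_lt => //; apply: finite_image; apply: finite_finset.
have mu_chi : [set: mu] #<= [set: chi] by apply: card_le_trans mu_le Lam_lt.1.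
have [||v Cv elv] := @homogeneous_add _ _ _ _ _ _ C_hom C chi R (c ord0) C_hom cu' _ _ (Cc _).
- by move=> x y /RM[Cx /model_sub].
- exact: card_lt_le_r ran_lt mu_chi.
have [|w Mw vw] := model_realizes _ ran_lt Cv.
  by move=> y [x /RM[]].
exists (fun i => if unlift ord0 i is Some j then u' j else w).
  by move=> i; case: (unlift ord0 i).
apply: el_comp elv vw _ => x y [[Bx <-]|[i [-> ->]]].
  exists x; first by left; left.
  by left; split=> //; exists x; left.
case: unliftP => [j ->|->]; last by exists v; right.
exists (u' j); first by left; right; exists j.
by left; split=> //; exists (c (lift ord0 j)); right; exists j.
Qed.

Lemma model_homogeneous : homogeneous I D chi C mu model.
Proof.
split.
  split; first exact: omega_submodel model_sub model_omega.
    by move=> n c Mc; apply: (D_set_C C_hom) => i; apply: model_sub.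
  right; split; first exact: model_sub.
  exact: card_lt_le model_le Lam_lt.
move=> B n p BM Bmu pS.
have Bchi : B #< [set: chi].
  by apply: card_lt_le_r Bmu _; apply: card_le_trans mu_le Lam_lt.1.
have [c Cc pE] := S_D_realized C_hom (subset_trans BM model_sub) Bchi pS.
have [u Mu cu] := model_realizes_tuple BM Bmu Cc.
exists u; split=> //; rewrite pE; have /tpP -> := cu.
by move=> phi [].
Qed.

(** Isolation was arranged among elements of [C]; this suffices, as types in [S_D] over fewer than
    chi elements are realized there. *)
Lemma model_constructible : constructible I D mu A model.
Proof.
have [B BP] := choice f_iso.
exists K, (fun x y => `[< RK x y \/ x = y >]), f, B; split=> //.
  exact: swo_well_order.
move=> i; have [RKmin RKtr RKtot RKirr] := RK_wo.
have -> : A `|` [set f j | j in [set j | `[< RK j i \/ j = i >] /\ j <> i]] = below f i.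
  congr (_ `|` _); apply/seteqP; split=> y [j].
    by move=> [/asboolP[ji|//] _ <-]; exists j.
  move=> ji <-; exists j => //; split; first by apply/asboolP; left.
  by move=> e; move: ji; rewrite e => /RKirr.
have bC : below f i `<=` C by move=> y [/A_sub //|[j _ <-]].
have [Bb Bmu isoB] := BP i; split=> //.
  by apply: (S_D_tp C_hom bC) => _; apply: Cf.
move=> q qS qB.
have bchi : below f i #< [set: chi] by apply: card_lt_le (card_AK _ _) Lam_lt.
have [c Cc qE] := S_D_realized C_hom bC bchi qS.
have fc : simt (B i) (fun _ : 'I_1 => f i) c.
  apply: realizes_tp => phi [phiB fphi].
  have : q phi by apply: qB; split=> //; split=> // x /phiB/Bb.
  by rewrite qE => -[].
have cE : c = fun=> c ord0 by apply/funext => j; rewrite (ord1 j).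
rewrite qE; apply/tpP; rewrite cE in fc *.
by apply: simt_sym; apply/simtP; apply: isoB => //; apply/simtP.
Qed.

(** * Primeness *)

Lemma model_prime : prime_over I D chi C mu A model.
Proof.
split; [by move=> x ?; left|exact: model_homogeneous|move=> N N_hom AN].
have NC : N `<=` C by have [[_ _ [e|[]//]] _] := N_hom; rewrite e.
have [RKmin RKtr RKtot RKirr] := RK_wo.
pose Rel g (S : set K) x y := diag A x y \/ exists2 j, S j & x = f j /\ y = g j.
(* A finite part of [Rel g S] lies in the identity of [A] or has a greatest index [j], whose
   hypothesis covers it. *)
have Rel_el g (S : set K) :
    (forall j, S j -> el (add (Rel g (RK^~ j)) (f j) (g j))) -> el (Rel g S).
  move=> gS; apply: el_fin => l lR.
  have [lA|[j Sj lj]] : (forall p, List.In p l -> diag A p.1 p.2) \/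
      exists2 j, S j & forall p, List.In p l ->
        add (Rel g (RK^~ j)) (f j) (g j) p.1 p.2.
    elim: l lR => [|[x y] l IH] lR; first by left.
    have {}IH := IH (fun p lp => lR p (or_intror lp)).
    have [/= Axy|[j Sj /= [-> ->]]] := lR (x, y) (or_introl erefl).
      case: IH => [lA|[j Sj lj]]; [left|right; exists j => //].
        by move=> p [<- //|]; apply: lA.
      by move=> p [<-|]; [left; left|apply: lj].
    right; case: IH => [lA|[k Sk lk]].
      by exists j => // p [<-|/lA]; [right|left; left].
    have mono i i' : RK i i' -> forall p : U * U,
        add (Rel g (RK^~ i)) (f i) (g i) p.1 p.2 ->
        add (Rel g (RK^~ i')) (f i') (g i') p.1 p.2.
      move=> ii' p [[Ap|[i2 /= ii2 e]]|e]; left; [by left|right..].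
        by exists i2 => //; apply: RKtr ii2 ii'.
      by exists i.
    have [jk|ejk|kj] := RKtot j k.
    - exists k => // p [<-|/lk //]; left; right.
      by exists j.
    - by exists k => // p [<-|/lk //]; rewrite ejk; right.
    - by exists j => // p [<-|/lk]; [right|apply: mono].
  + apply: (el_sub (@el_diag _ _ I A)) => x y xy.
    exact: (lA (x, y)).
  + apply: (el_sub (gS j Sj)) => x y xy.
    exact: (lj (x, y)).
have [g gP] : exists g : K -> U, forall i,
    N (g i) /\ el (add (Rel g (RK^~ i)) (f i) (g i)).
  apply: (wf_choice c0 RK_wo (P := fun i g u =>
    N u /\ el (add (Rel g (RK^~ i)) (f i) u))).
    move=> i g g' u gg' [Nu elu]; split=> //; apply: el_sub elu _ => x y.
    case=> [[Ax|[j /[dup] /= ji /gg' <- e]]|]; [by left; left| |by right].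
    by left; right; exists j.
  move=> i g gP; set R := Rel g (RK^~ i).
  have elR : el R by apply: Rel_el => j /gP[].
  have RN x y : R x y -> C x /\ N y.
    case=> [[Ax <-]|[j /gP[Ng _] [-> ->]]]; last by split.
    by split; [apply: A_sub|apply: AN].
  have Rdom x : below f i x -> exists y, R x y.
    by move=> [Ax|[j ji <-]]; [exists x; left|exists (g j); right; exists j].
  have [B [Bb Bmu isoB]] := f_iso i.
  (* Restriction to the isolating set brings the range below mu, as the homogeneity of [N]
     requires. *)
  pose RB x y := B x /\ R x y.
  have ranB : [set y | exists x, RB x y] #< [set: mu].
    apply: card_lt_le Bmu.
    have /choice[h hP] x : exists y, below f i x -> R x y.
      have [/Rdom[y Rxy]|] := pselect (below f i x); first by exists y.
      by exists c0.
    apply: (@card_le_imageT _ _ _ _ h) => y [x [Bx Rxy]]; exists x => //.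
    exact: el_fun elR (hP x (Bb _ Bx)) Rxy.
  have elRB : el RB by apply: el_sub elR _ => x y [].
  have [|u Nu elu] := homogeneous_add C_hom N_hom elRB _ ranB (Cf i).
    by move=> x y [_ /RN].
  (* [u] is pulled back through [R] to [v] in [C]. As [v] and [f i] agree over [B], isolation makes
     them agree over all of [below f i]. *)
  have [||v Cv elv] := @homogeneous_add _ _ _ _ _ _ C_hom C chi _ u C_hom
      (el_inv elR) _ _ (NC _ Nu).
  - by move=> y x /RN[Cx /NC].
  - apply: card_lt_le Lam_lt; apply: card_le_trans model_le.
    apply: subset_card_le => x [y [[Ax _]|[j _ [-> _]]]]; first by left.
    by right; exists j.
  have fv : sim B (f i) v.
    apply: el_comp elu elv _ => x y [[Bx <-]|[-> ->]]; last by exists u; right.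
    by have [z Rxz] := Rdom _ (Bb _ Bx); exists z; left.
  exists u; split=> //.
  apply: el_comp (isoB v Cv fv) (el_inv elv) _ => x y [Rxy|[-> ->]].
    exists x; last by left.
    left; split=> //; case: Rxy => [[Ax _]|[j ji [-> _]]]; first by left.
    by right; exists j.
  by exists v; right.
have elg : el (Rel g setT) by apply: Rel_el => j _; case: (gP j).
have /choice[h hP] x : exists y, model x -> Rel g setT x y.
  have [[Ax|[j _ <-]]|] := pselect (model x); last by exists c0.
  - by exists x; left.
  - by exists (g j); right; exists j.
exists h; split.
- by move=> n phi c Mc; apply: elg => i; apply: hP.
- move=> _ [x /hP Rx <-]; case: Rx => [[Ax <-]|[j _ [_ ->]]]; first exact: AN.
  by case: (gP j).
- move=> x Ax; apply: (el_fun elg (x := x)); first by apply: hP; left.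
  by left.
Qed.

(** * Cardinality *)

(** A model smaller than mu would realize the type over itself of some [c] outside it, and [c] would
    equal the realization. *)
Lemma mu_le_model (C_card : [set: chi] #<= C) : [set: mu] #<= model.
Proof.
have [//|Mmu] := card_le_total_set [set: mu] model.
apply: contrapT => nle; have Mlt : model #< [set: mu] by split.
have [c [Cc nMc]] : exists c, C c /\ ~ model c.
  apply: contrapT => nc; apply: Lam_lt.2; apply: card_le_trans C_card _.
  apply: card_le_trans model_le; apply: subset_card_le => c Cc.
  by apply: contrapT => nMc; apply: nc; exists c.
have [u Mu cu] := model_realizes (@subset_refl _ _) Mlt Cc.
apply: nMc; suff -> : c = u by [].
by apply: (el_inj cu (y := u)); [right|left].
Qed.

(** A type realized in [C] is realized in the model, which has no more finite tuples than
    elements. *)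
Lemma realized_le (C_card : [set: chi] #<= C) :
  total_set (realized I D C) #<= [set: model].
Proof.
have MTinf : infinite_set [set: model].
  apply: contra_not mu_inf; apply: card_le_finite.
  by rewrite (card_le_eqr (card_setT _)); apply: mu_le_model.
apply: card_le_trans (card_seqT MTinf).
pose F (l : seq model) : {n & set (fmla L 'I_n)} := existT _ (size l)
  (tp0 I (fun i : 'I_(size l) => nth c0 (map \val l) i)).
apply: (@card_le_imageT _ _ _ _ F) => -[n p] [/= Dp [c [Cc pE]]].
have [||u Mu cu] := @model_realizes_tuple set0 n c _ _ Cc.
- by [].
- by apply: finite_card_lt => //.
pose l := [seq SigSub (mem_set (Mu i)) : model | i <- enum 'I_n].
exists l => //.
have lsz : size l = n by rewrite size_map size_enum_ord.
have ln i : (i < n)%N -> forall d, nth d (map \val l) i = nth d (map u (enum 'I_n)) i.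
  by move=> _ d; rewrite /l -map_comp.
have {}ln (i : 'I_n) : nth c0 (map \val l) i = u i.
  by rewrite ln // (nth_map i) ?size_enum_ord // nth_ord_enum.
have -> : p = tp0 I u.
  rewrite pE; apply/seteqP; split=> phi /=; rewrite /tp0 /=;
  by apply (cu n c u) => i; right; exists i.
have cast k (e : k = n) (w : 'I_k -> U) : (forall i, w (cast_ord (esym e) i) = u i) ->
    existT (fun n => set (fmla L 'I_n)) k (tp0 I w) = existT _ n (tp0 I u).
  case: n / e u {c Cc pE Dp p cu Mu l lsz ln} => u wu.
  suff -> : w = u by [].
  by apply/funext => i; rewrite -wu; congr w; apply: val_inj.
by apply: (cast _ lsz) => i; rewrite /= ln.
Qed.

End Diagram.

Theorem theorem5p6
  (L : language) (T : theory L)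
  (U : Type) (I : interp L U)
  (D : forall n, set (set (fmla L 'I_n)))
  (chi : Type) (C : set U)
  (T_model : is_model T I) (sat_I : saturated I)
  (D_sub : forall n, D n `<=` DT T (n := n))
  (C_hom : homogeneous I D chi C chi C)
  (C_card : [set: chi] #<= C)
  (D_tt : totally_transcendental I D C)
  (A : set U) (mu : Type)
  (A_sub : A `<=` C)
  (mu_inf : infinite_set [set: mu])
  (chi_large : A #+ formulas T #+ total_set D #+ [set: mu] #< [set: chi]) :
  exists M : set U,
    [/\ primary I D chi C mu A M,
        A #+ total_set (realized I D C) #+ [set: mu] #<= M,
        M #<= A #+ formulas T #+ total_set D #+ [set: mu] &
        prime_over I D chi C mu A M].
Proof.
set S := A #+ formulas T #+ total_set D #+ [set: mu] in chi_large *.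
(* The sum [S], as a type, serves as [Lam], the index of the elements within a stage. *)
have ST := card_setT S.
have mu_le : [set: mu] #<= [set: S].
  by rewrite (card_le_eqr ST); apply: card_le_addr.
have D_le : total_set D #<= [set: S].
  rewrite (card_le_eqr ST); apply: card_le_trans (card_le_addl _ _).
  exact: card_le_addr.
have A_le : A #<= [set: S].
  rewrite (card_le_eqr ST); apply: card_le_trans (card_le_addl _ _).
  apply: card_le_trans (card_le_addl _ _).
  exact: card_le_addl.
have Lam_lt : [set: S] #< [set: chi].
  by apply: card_lt_le chi_large; rewrite (card_le_eql ST).
have chi_inf : infinite_set [set: chi].
  apply: contra_not mu_inf; apply: card_le_finite.
  exact: card_le_trans mu_le Lam_lt.1.
have [c0 Cc0] : C !=set0.
  by apply: infinite_setN0; apply: contra_not chi_inf; apply: card_le_finite.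
have [Rmu [Rmin Rtr Rtot Rirr Rmu_initial]] := initial_well_order mu.
have Rmu_wo : swo Rmu by [].
have [RLam [Lmin Ltr Ltot Lirr _]] := initial_well_order S.
have RLam_wo : swo RLam by [].
have [f [Cf f_iso f_real]] := exists_construction C_hom D_tt A_sub mu_inf A_le
  mu_le D_le Cc0 Rmu_wo RLam_wo.
have M_hom := model_homogeneous C_hom chi_inf D_tt c0 A_sub mu_inf A_le mu_le
  Lam_lt Rmu_wo Rmu_initial Cf f_real.
have M_cons := model_constructible C_hom A_sub mu_inf A_le mu_le Lam_lt Rmu_wo
  RLam_wo Cf f_iso.
have M_prime := model_prime C_hom chi_inf D_tt c0 A_sub mu_inf A_le mu_le Lam_lt
  Rmu_wo Rmu_initial RLam_wo Cf f_iso f_real.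
have mu_le_M := mu_le_model C_hom chi_inf D_tt c0 A_sub mu_inf A_le mu_le Lam_lt
  Rmu_wo Rmu_initial Cf f_real C_card.
have D_le_M := realized_le C_hom chi_inf D_tt c0 A_sub mu_inf A_le mu_le Lam_lt
  Rmu_wo Rmu_initial Cf f_real C_card.
have MT := card_setT (model A f).
rewrite -(card_le_eqr MT) in mu_le_M.
have MTinf : infinite_set [set: model A f].
  by apply: contra_not mu_inf; apply: card_le_finite.
exists (model A f); split=> //.
- rewrite -(card_le_eqr MT); apply: card_add_leT => //; apply: card_add_leT => //.
  by rewrite (card_le_eqr MT); apply: subset_card_le => x Ax; left.
- rewrite -(card_le_eqr ST); exact: model_le mu_inf A_le mu_le f.
Qed.
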